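(* Consider a robust Markov decision process with $S$ states, $A$ actions and the $s$-rectangular Burg entropy ambiguity set ($\phi(t)=-\log t+t-1$) with budget $\kappa>0$ described in the context, with robust Bellman operator $\mathfrak{J}$. For every $\bm{v}\in\mathbb{R}^S$ with $\bm{v}\le\bm{v}^\star$ and $\bm{r}_{sa}+\lambda\bm{v}\ge\bm{0}$ for all $s\in\mathcal{S}$, $a\in\mathcal{A}$, the robust Bellman iteration $\mathfrak{J}(\bm{v})$ (across all states) can be computed to any accuracy $\epsilon>0$ in time $$\mathcal{O}\left(S^2\cdot A\log A\cdot\log\left[\frac{\overline{R}^2}{\epsilon^2\kappa}\right]\cdot\log\frac{\overline{R}}{\epsilon}\right).$$
   Context: Notation: $\Delta_n=\{\bm{p}\in\mathbb{R}^n_+ : \mathbf{e}^\top\bm{p}=1\}$ with $\mathbf{e}$ the all-ones vector. Inequalities between vectors are component-wise. Robust MDP: finite state space $\mathcal{S}=\{1,\dots,S\}$, finite action space $\mathcal{A}=\{1,\dots,A\}$, discount factor $\lambda\in(0,1)$, rewards $r_{sas'}\in\mathbb{R}_+$ with $\bm{r}_{sa}=(r_{sas'})_{s'\in\mathcal{S}}$, nominal transition probabilities $\overline{\bm{p}}_{sa}\in\Delta_S$ with $\overline{\bm{p}}_{sa}>\bm{0}$. With $\phi(t)=-\log t+t-1$ ($\log 0=-\infty$, so $\phi(0)=+\infty$), let $d_a(\bm{p}_{sa},\overline{\bm{p}}_{sa})=\sum_{s'\in\mathcal{S}}\overline{p}_{sas'}\,\phi(p_{sas'}/\overline{p}_{sas'})$.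 For a budget $\kappa>0$, the ambiguity set of state $s$ is $\mathcal{P}_s=\{\bm{p}_s=(\bm{p}_{sa})_{a\in\mathcal{A}}\in(\Delta_S)^A : \sum_{a\in\mathcal{A}}d_a(\bm{p}_{sa},\overline{\bm{p}}_{sa})\le\kappa\}$. The robust Bellman operator $\mathfrak{J}:\mathbb{R}^S\to\mathbb{R}^S$ is $$[\mathfrak{J}(\bm{v})]_s=\max_{\bm{\pi}_s\in\Delta_A}\ \min_{\bm{p}_s\in\mathcal{P}_s}\ \sum_{a\in\mathcal{A}}\pi_{sa}\cdot\bm{p}_{sa}^\top(\bm{r}_{sa}+\lambda\bm{v}),\qquad s\in\mathcal{S},$$ and $\bm{v}^\star$ denotes the limit of the iteration $\bm{v}^{t+1}=\mathfrak{J}(\bm{v}^t)$ (the fixed point of $\mathfrak{J}$). Further, $\overline{R}=(1-\lambda)^{-1}\max\{r_{sas'} : s,s'\in\mathcal{S},\ a\in\mathcal{A}\}$. $\mathfrak{J}(\bm{v})$ is computed to accuracy $\epsilon$ by any $\bm{v}'\in\mathbb{R}^S$ with $\|\bm{v}'-\mathfrak{J}(\bm{v})\|_\infty\le\epsilon$. Running time counts elementary operations on real numbers (arithmetic, comparisons, evaluations of elementary functions such as $\exp$ and $\log$), each at unit cost. *)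

(* Defs.v *)
From HB Require Import structures.
From mathcomp Require Import all_boot all_order all_algebra.
From mathcomp Require Import all_classical all_reals.
From mathcomp Require Import ereal topology normedtype sequences exp.

Set Implicit Arguments.
Unset Strict Implicit.
Unset Printing Implicit Defensive.

Import Order.TTheory GRing.Theory Num.Theory.
Import numFieldNormedType.Exports.

Local Open Scope classical_set_scope.
Local Open Scope ring_scope.

Section RobustMDP.
Context {R : realType}.

Definition simplex (n : nat) : set ('I_n -> R) :=
  [set p | (forall i, 0 <= p i) /\ \sum_(i < n) p i = 1].

Record rmdp (nS nA : nat) := RMDP {
  discount : R;
  budget : R;
  reward : 'I_nS -> 'I_nA -> 'I_nS -> R;
  nominal : 'I_nS -> 'I_nA -> 'I_nS -> R;
  discount_gt0 : 0 < discount;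
  discount_lt1 : discount < 1;
  budget_gt0 : 0 < budget;
  reward_ge0 : forall s a s', 0 <= reward s a s';
  nominal_simplex : forall s a, simplex (nominal s a);
  nominal_gt0 : forall s a s', 0 < nominal s a s'
}.

(* Extended-real valued because phi 0 = +oo ([lne 0 = -oo], whereas [ln 0 = 0]);
   only used at nonnegative arguments. *)
Definition burg (t : R) : \bar R := (- lne t%:E + t%:E - 1%:E)%E.

Definition burg_divergence (n : nat) (p q : 'I_n -> R) : \bar R :=
  (\sum_(i < n) (q i)%:E * burg (p i / q i))%E.

Section Operator.
Context (nS nA : nat) (M : rmdp nS nA).

Definition ambiguity (s : 'I_nS) : set ('I_nA -> 'I_nS -> R) :=
  [set p | (forall a, simplex (p a)) /\
           (\sum_(a < nA) burg_divergence (p a) (nominal M s a)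
              <= (budget M)%:E)%E].

Definition payoff (v : 'I_nS -> R) (s : 'I_nS)
    (pi : 'I_nA -> R) (p : 'I_nA -> 'I_nS -> R) : R :=
  \sum_(a < nA)
    pi a * \sum_(s' < nS) p a s' * (reward M s a s' + discount M * v s').

(* The minimum and the maximum are written [inf] and [sup]; they are attained,
   [ambiguity M s] and [simplex nA] being compact and nonempty. *)
Definition bellman (v : 'I_nS -> R) (s : 'I_nS) : R :=
  sup [set inf [set payoff v s pi p | p in ambiguity s]
        | pi in simplex (n := nA)].

Definition value_bound : R :=
  (1 - discount M)^-1 *
  \big[Num.max/0]_(s < nS) \big[Num.max/0]_(a < nA) \big[Num.max/0]_(s' < nS)
     reward M s a s'.

End Operator.

Definition sup_norm (n : nat) (x : 'I_n -> R) : R :=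
  \big[Num.max/0]_(i < n) `|x i|.

End RobustMDP.

(* A real random-access machine, presented as a while language.  Its store has
   integer registers, used for addressing and loop control, and real arrays; a
   real variable is a cell of an array.  A program is a finite piece of syntax
   whose only constants are natural numbers, so that one program handles all
   sizes and all real data. *)

Inductive iexp : Type :=
  | ICst of nat
  | IReg of nat
  | IAdd of iexp & iexp
  | IMul of iexp & iexp.

Inductive rexp : Type :=
  | RCst of nat
  | RGet of nat & iexp
  | RAdd of rexp & rexp
  | RSub of rexp & rexp
  | RMul of rexp & rexp
  | RDiv of rexp & rexp
  | RExp of rexp
  | RLn of rexp.

Inductive test : Type :=
  | RLe of rexp & rexp
  | ILt of iexp & iexp.

Inductive cmd : Type :=
  | Skip
  | ISet of nat & iexp
  | RSet of nat & iexp & rexp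
  | Seq of cmd & cmd
  | If of test & cmd & cmd
  | While of test & cmd.

(* Every node of an expression is one operation: running time counts the index
   arithmetic and the memory accesses as well as the real operations. *)
Fixpoint icost (e : iexp) : nat :=
  match e with
  | ICst _ | IReg _ => 1
  | IAdd e1 e2 | IMul e1 e2 => (icost e1 + icost e2).+1
  end.

Fixpoint rcost (e : rexp) : nat :=
  match e with
  | RCst _ => 1
  | RGet _ i => (icost i).+1
  | RAdd e1 e2 | RSub e1 e2 | RMul e1 e2 | RDiv e1 e2 =>
      (rcost e1 + rcost e2).+1
  | RExp e1 | RLn e1 => (rcost e1).+1
  end.

Definition tcost (t : test) : nat :=
  match t with
  | RLe e1 e2 => (rcost e1 + rcost e2).+1
  | ILt e1 e2 => (icost e1 + icost e2).+1
  end.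

Section Machine.
Context {R : realType}.

Record store := Store { ireg : nat -> nat; cell : nat -> nat -> R }.

Definition set_ireg (st : store) (x n : nat) : store :=
  Store (fun y => if y == x then n else ireg st y) (cell st).

Definition set_cell (st : store) (b i : nat) (z : R) : store :=
  Store (ireg st)
    (fun b' i' => if (b' == b) && (i' == i) then z else cell st b' i').

Fixpoint ieval (st : store) (e : iexp) : nat :=
  match e with
  | ICst n => n
  | IReg x => ireg st x
  | IAdd e1 e2 => (ieval st e1 + ieval st e2)%N
  | IMul e1 e2 => (ieval st e1 * ieval st e2)%N
  end.

(* Division by 0 and logarithms of nonpositive numbers return 0.  A comparison
   detects these cases, so this convention gives programs no extra power. *)
Fixpoint reval (st : store) (e : rexp) : R :=
  match e with
  | RCst n => n%:R
  | RGet b i => cell st b (ieval st i)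
  | RAdd e1 e2 => reval st e1 + reval st e2
  | RSub e1 e2 => reval st e1 - reval st e2
  | RMul e1 e2 => reval st e1 * reval st e2
  | RDiv e1 e2 => reval st e1 / reval st e2
  | RExp e1 => expR (reval st e1)
  | RLn e1 => ln (reval st e1)
  end.

Definition teval (st : store) (t : test) : bool :=
  match t with
  | RLe e1 e2 => reval st e1 <= reval st e2
  | ILt e1 e2 => (ieval st e1 < ieval st e2)%N
  end.

(* [exec c st T st']: started in [st], the program [c] halts in [st'] after [T]
   operations. *)
Inductive exec : cmd -> store -> nat -> store -> Prop :=
  | exec_skip st : exec Skip st 1 st
  | exec_iset st x e :
      exec (ISet x e) st (icost e).+1 (set_ireg st x (ieval st e))
  | exec_rset st b i e :
      exec (RSet b i e) st (icost i + rcost e).+1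
        (set_cell st b (ieval st i) (reval st e))
  | exec_seq st st1 st2 c1 c2 T1 T2 :
      exec c1 st T1 st1 -> exec c2 st1 T2 st2 ->
      exec (Seq c1 c2) st (T1 + T2) st2
  | exec_if st st1 t c1 c2 T :
      exec (if teval st t then c1 else c2) st T st1 ->
      exec (If t c1 c2) st (tcost t + T) st1
  | exec_while_stop st t c :
      ~~ teval st t -> exec (While t c) st (tcost t) st
  | exec_while_step st st1 st2 t c T1 T2 :
      teval st t -> exec c st T1 st1 -> exec (While t c) st1 T2 st2 ->
      exec (While t c) st (tcost t + T1 + T2) st2.

Lemma exec_deterministic c st T1 st1 T2 st2 :
  exec c st T1 st1 -> exec c st T2 st2 -> T1 = T2 /\ st1 = st2.
Proof.
move=> h; elim: h T2 st2 => {c st T1 st1}.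
- by move=> st T2 st2 h; inversion h.
- by move=> st x e T2 st2 h; inversion h.
- by move=> st b i e T2 st2 h; inversion h.
- move=> st st1 st2 c1 c2 T1 T2 _ ih1 _ ih2 T3 st3 h.
  inversion h as [| | |? sm ? ? ? Ta Tb ha hb| | |]; subst.
  by have [? ?] := ih1 _ _ ha; subst; have [-> ->] := ih2 _ _ hb.
- move=> st st1 t c1 c2 T _ ih T2 st2 h.
  inversion h as [| | | |? ? ? ? ? Ta ha| |]; subst.
  by have [-> ->] := ih _ _ ha.
- move=> st t c nt T2 st2 h.
  inversion h as [| | | | |? ? ? nt'|? sm ? ? ? Ta Tb tt ha hb]; subst=> //.
  by rewrite tt in nt.
- move=> st st1 st2 t c T1 T2 tt _ ih1 _ ih2 T3 st3 h.
  inversion h as [| | | | |? ? ? nt|? sm ? ? ? Ta Tb tt' ha hb]; subst.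
    by rewrite tt in nt.
  by have [? ?] := ih1 _ _ ha; subst; have [-> ->] := ih2 _ _ hb.
Qed.

(* The layout of the input; three-index data are stored in row-major order.
   The rest of the store is arbitrary. *)
Record loaded (nS nA : nat) (M : rmdp (R := R) nS nA) (v : 'I_nS -> R)
    (eps : R) (st : store) : Prop := Loaded {
  loaded_nS : ireg st 0 = nS;
  loaded_nA : ireg st 1 = nA;
  loaded_discount : cell st 0 0 = discount M;
  loaded_budget : cell st 0 1 = budget M;
  loaded_eps : cell st 0 2 = eps;
  loaded_reward : forall (s : 'I_nS) (a : 'I_nA) (s' : 'I_nS),
    cell st 1 ((s * nA + a) * nS + s')%N = reward M s a s';
  loaded_nominal : forall (s : 'I_nS) (a : 'I_nA) (s' : 'I_nS),
    cell st 2 ((s * nA + a) * nS + s')%N = nominal M s a s';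
  loaded_v : forall s : 'I_nS, cell st 3 s = v s
}.

Definition output (nS : nat) (st : store) (s : 'I_nS) : R := cell st 4 s.

(* Logarithmic factor of a running-time bound, cut off below at 1: the
   logarithms of the bound vanish or are negative for some admissible data
   (a single action, or a coarse accuracy), but a running time is positive. *)
Definition logf (x : R) : R := Num.max 1 (ln x).

End Machine.

Arguments store : clear implicits.

(* Main.v *)
(* By minimax, [bellman M v s] is the least [theta] such that the divergences of
   the cheapest distributions of expected gain at most [theta], one per action,
   sum up to at most [budget M].  The divergence for an action is the maximum of
   the concave function [dual_value x = \sum_i q i * ln (1 + x * (b i - theta))]
   over [0 <= x < (theta - min b)^-1], where [q] are the nominal probabilities
   and [b] the gains.  The program bisects over [theta] and, for each [theta] and
   each action, over [x], guided by the sign of the derivative.  As this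
   derivative is at most [beta := max b] to the right of 0, an interval of length
   [w] for [x] determines the divergence up to [beta * w], whatever the nominal
   probabilities are; accuracy [budget * eps / (4 nA beta)] suffices, because a
   distribution that exceeds the budget by a fraction [t] becomes feasible when
   it is moved by [t] towards the nominal one, at a cost of [t * beta].  Since
   [theta - min b >= eps / 4] throughout, the inner bisection takes
   [log (16 nA beta^2 / (eps^2 budget))] steps.

   The minimax theorem itself is not used: an overspent budget yields a policy
   (proportional to the multipliers [x]) worth at least [theta], and a respected
   one yields transition probabilities that hold every policy below
   [theta + eps / 4]. *)
Require Import Defs.
From mathcomp Require Import all_boot all_order all_algebra.
From mathcomp Require Import all_classical all_reals.
From mathcomp Require Import ereal topology normedtype sequences exp.
From mathcomp Require Import ring lra zify.

Import Order.TTheory GRing.Theory Num.Theory.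
Import numFieldNormedType.Exports.

Local Open Scope classical_set_scope.
Local Open Scope ring_scope.

(** * Duality for one action *)

Lemma ln_le_subr1 {R : realType} (x : R) : 0 < x -> ln x <= x - 1.
Proof.
by move=> x0; rewrite -{1}(subrK 1 x) addrC; apply: le_ln1Dx; rewrite ltrBDr addNr.
Qed.

Section Row.
Context {R : realType} {n : nat} (q b : 'I_n -> R) (theta : R).

Definition dual_value (x : R) : R :=
  \sum_(i < n) q i * ln (1 + x * (b i - theta)).

Definition dual_slope (x : R) : R :=
  \sum_(i < n) q i * ((b i - theta) / (1 + x * (b i - theta))).

Lemma dual_domain (x m : R) : (forall i, m <= b i) -> 0 <= x ->
  x * (theta - m) < 1 -> forall i, 0 < 1 + x * (b i - theta).
Proof.
move=> mb x0 xm i; rewrite -(opprB theta) mulrN subr_gt0.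
by apply: le_lt_trans xm; rewrite ler_wpM2l// lerB.
Qed.

Hypothesis q_gt0 : forall i, 0 < q i.

(** The tangent-line bound of a concave function, summand by summand from [ln t <= t - 1] at the
    ratio of the two arguments. *)
Lemma dual_value_sub_le (x y : R) :
  (forall i, 0 < 1 + x * (b i - theta)) ->
  (forall i, 0 < 1 + y * (b i - theta)) ->
  dual_value y - dual_value x <= (y - x) * dual_slope x.
Proof.
move=> hx hy; rewrite /dual_value -sumrB mulr_sumr; apply: ler_sum => i _.
rewrite -mulrBr mulrCA ler_wpM2l ?(ltW (q_gt0 i))//.
rewrite -ln_div ?posrE//.
apply: le_trans (ln_le_subr1 _ _) _; first by rewrite divr_gt0.
by have := hx i; move=> /lt0r_neq0 h; rewrite le_eqVlt; apply/orP; left; apply/eqP; field.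
Qed.

(** After cross-multiplication two summands differ by [(y - x) * c ^ 2]; as [0 <= x <= y],
    positivity of the denominators at [y] passes to [x]. *)
Lemma dual_slope_antitone (x y : R) : 0 <= x <= y ->
  (forall i, 0 < 1 + y * (b i - theta)) -> dual_slope y <= dual_slope x.
Proof.
move=> /andP[x0 xy] hy; apply: ler_sum => i _.
rewrite ler_wpM2l ?(ltW (q_gt0 i))//.
have := hy i; set c := b i - theta => hc.
have hx : 0 < 1 + x * c.
  have [c0|c0] := leP 0 c; first by rewrite ltr_wpDr// mulr_ge0.
  by apply: lt_le_trans hc _; rewrite lerD2l ler_wnM2r// ltW.
rewrite ler_pdivrMr// mulrAC ler_pdivlMr//.
rewrite -subr_ge0; have -> : c * (1 + y * c) - c * (1 + x * c) = (y - x) * (c * c) by ring.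
by rewrite mulr_ge0 ?subr_ge0// -expr2 sqr_ge0.
Qed.

Hypothesis q1 : \sum_(i < n) q i = 1.

(** At the origin the denominators are 1, so the slope is the nominal mean gain minus [theta]. By
    monotonicity [beta] then bounds the slope everywhere to the right of 0. *)
Lemma dual_slope0_le (beta : R) : 0 <= theta ->
  (forall i, b i <= beta) -> dual_slope 0 <= beta.
Proof.
move=> t0 hb; rewrite /dual_slope -[leRHS]mul1r -[in leRHS]q1 mulr_suml.
apply: ler_sum => i _; rewrite ler_wpM2l ?(ltW (q_gt0 i))//.
by rewrite mul0r addr0 divr1 lerBlDr; apply: le_trans (hb i) _; rewrite lerDl.
Qed.

Lemma dual_slope_continuous (x : R) :
  (forall i, 0 < 1 + x * (b i - theta)) -> {for x, continuous dual_slope}.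
Proof.
move=> hx; rewrite /dual_slope /continuous_at.
apply: (@cvg_big _ _ +%R 0) => [|i _]; first exact: add_continuous.
apply: cvgM; first exact: cvg_cst.
apply: cvgM; first exact: cvg_cst.
apply: cvgV; first by rewrite gt_eqF.
by apply: cvgD; [exact: cvg_cst|apply: cvgM; [exact: cvg_id|exact: cvg_cst]].
Qed.

(* Complementary slackness for the maximization of the concave [dual_value];
   towards the right end of its domain the slope is at most
   [- q j * d / u + \sum_i q i * `|b i - theta|], where [d := theta - b j] and
   [u] is the relative distance to that end. *)
Lemma dual_optimum (j : 'I_n) : (forall i, b j <= b i) -> b j < theta ->
  exists x, [/\ 0 <= x, x * (theta - b j) < 1, dual_slope x <= 0
              & x * dual_slope x = 0].
Proof.
move=> bj jt; set d := theta - b j; have d0 : 0 < d by rewrite subr_gt0.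
have [s0|s0] := leP (dual_slope 0) 0.
  by exists 0; rewrite lexx !mul0r ltr01.
have pos x : 0 <= x -> x * d < 1 -> _ := dual_domain x _ bj.
pose W := \sum_(i < n) q i * `|b i - theta|.
have Wj : q j * d <= W.
  rewrite /W (bigD1 j)//= -[leLHS]addr0 lerD//.
    by rewrite ler_wpM2l ?(ltW (q_gt0 j))// distrC ler_norm.
  by apply: sumr_ge0 => i _; rewrite mulr_ge0 ?(ltW (q_gt0 i)).
have qd0 : 0 < q j * d by rewrite mulr_gt0.
have W0 : 0 < W by exact: lt_le_trans Wj.
(* This [u] makes the term of [j] in [dual_slope x1] equal to [- W], which outweighs all the other
   terms together. *)
pose u := q j * d / W.
have u0 : 0 < u by rewrite divr_gt0.
have u1 : u <= 1 by rewrite ler_pdivrMr// mul1r.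
pose x1 := (1 - u) / d.
have x10 : 0 <= x1 by rewrite divr_ge0 ?subr_ge0// ltW.
have x1d : x1 * d = 1 - u by rewrite /x1 divfK// gt_eqF.
have x1d1 : x1 * d < 1 by rewrite x1d ltrBlDr ltrDl.
have sx1 : dual_slope x1 <= 0.
  rewrite /dual_slope (bigD1 j)//=.
  have -> : q j * ((b j - theta) / (1 + x1 * (b j - theta))) = - W.
    rewrite -(opprB theta) -/d mulrN x1d.
    have -> : 1 - (1 - u) = u by ring.
    rewrite /u; have := gt_eqF W0; have := gt_eqF qd0; rewrite mulf_eq0 => /norP[h1 h2] /negbT h3.
    by field; rewrite h1 h2 h3.
  rewrite addrC subr_le0 /W [leRHS](bigD1 j)//= ler_wpDl//.
    by rewrite mulr_ge0 ?(ltW (q_gt0 j)).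
  apply: ler_sum => i _; rewrite ler_wpM2l ?(ltW (q_gt0 i))//.
  have := pos _ x10 x1d1 i; set c := b i - theta => hc.
  have [c0|c0] := leP 0 c.
    rewrite ger0_norm// ler_pdivrMr// ler_peMr// lerDl mulr_ge0//.
  by rewrite (le_trans (ltW (_ : _ < 0)))// pmulr_llt0 ?invr_gt0.
have [] := @IVT R dual_slope 0 x1 0 x10.
- apply: continuous_in_subspaceT => x; rewrite inE /= in_itv/= => /andP[x0 xx1].
  apply: dual_slope_continuous; apply: pos => //.
  by apply: le_lt_trans x1d1; rewrite ler_wpM2r// ltW.
- by rewrite ge_min sx1 orbT/= le_max (ltW s0).
move=> x; rewrite in_itv/= => /andP[x0 xx1] sx.
exists x; split; rewrite ?sx ?mulr0//.
by apply: le_lt_trans x1d1; rewrite ler_wpM2r// ltW.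
Qed.

(* The minimizer of the divergence over [\sum_i p i * b i <= theta]. *)
Lemma dual_primal (x : R) :
  (forall i, 0 < 1 + x * (b i - theta)) -> dual_slope x <= 0 ->
  x * dual_slope x = 0 ->
  exists p, [/\ simplex p, forall i, 0 < p i, \sum_(i < n) p i * b i <= theta
    & \sum_(i < n) q i * ln (p i / q i) = - dual_value x].
Proof.
move=> hx sx xsx; exists (fun i => q i / (1 + x * (b i - theta))).
have p0 i : 0 < q i / (1 + x * (b i - theta)) by rewrite divr_gt0.
(* Each weight is [q i] minus [x] times its summand in [dual_slope x]; complementary slackness
   cancels the total correction. *)
have p1 : \sum_(i < n) q i / (1 + x * (b i - theta)) = 1.
  transitivity (\sum_(i < n) q i - x * dual_slope x); last by rewrite xsx subr0.
  rewrite mulr_sumr -sumrB; apply: eq_bigr => i _.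
  by field; rewrite gt_eqF.
split=> //; first by split=> // i; exact: ltW.
(* The expected excess over [theta] under these weights is [dual_slope x] itself. *)
- suff: \sum_(i < n) q i / (1 + x * (b i - theta)) * b i
      - \sum_(i < n) q i / (1 + x * (b i - theta)) * theta <= 0.
    by rewrite -mulr_suml p1 mul1r subr_le0.
  rewrite -sumrB.
  by apply: le_trans sx; apply: ler_sum => i _; rewrite -mulrBr mulrAC mulrA.
- rewrite /dual_value -sumrN; apply: eq_bigr => i _.
  have qi := gt_eqF (q_gt0 i).
  have -> : q i / (1 + x * (b i - theta)) / q i = (1 + x * (b i - theta))^-1.
    by field; rewrite qi gt_eqF.
  by rewrite lnV ?posrE// mulrN.
Qed.

End Row.

(** * Bounds on the robust Bellman operator *)

Section BurgDivergence.
Context {R : realType} {n : nat}.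
Implicit Types p q y : 'I_n -> R.

Lemma burg_EFin (x : R) : 0 < x -> burg x = (- ln x + x - 1)%:E.
Proof. by move=> x0; rewrite /burg lne_EFin. Qed.

(** The linear terms of [phi] contribute [p i - q i], which cancel in the sum because both vectors
    have mass 1. *)
Lemma burg_divergenceE p q : simplex p -> simplex q ->
  (forall i, 0 < p i) -> (forall i, 0 < q i) ->
  burg_divergence p q = (- \sum_(i < n) q i * ln (p i / q i))%:E.
Proof.
move=> [_ p1] [_ q1] p0 q0; rewrite /burg_divergence.
under eq_bigr do rewrite burg_EFin ?divr_gt0// -EFinM.
rewrite sumEFin; congr EFin.
have -> : - (\sum_(i < n) q i * ln (p i / q i)) =
    - (\sum_(i < n) q i * ln (p i / q i)) + (\sum_(i < n) p i - \sum_(i < n) q i).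
  by rewrite p1 q1 subrr addr0.
rewrite -sumrN -sumrB -big_split; apply: eq_bigr => i _ /=.
by field; rewrite gt_eqF.
Qed.

(** Fenchel inequality, from [ln t <= t - 1] at [t = y i * (p i / q i)]. For
    [y i = 1 + x * (b i - theta)] it is weak duality with multiplier [x]. *)
Lemma burg_divergence_ge p q y : simplex p ->
  (forall i, 0 < q i) -> (forall i, 0 < y i) ->
  ((\sum_(i < n) q i * ln (y i) + 1 - \sum_(i < n) p i * y i)%:E
    <= burg_divergence p q)%E.
Proof.
move=> [p0 p1] q0 y0; rewrite -p1 -big_split -sumrB -sumEFin.
apply: lee_sum => i _ /=.
have [pi0|pi0] := leP (p i) 0.
  (* A vanishing [p i] makes its divergence term [+oo], and the bound is trivial. *)
  have -> : p i = 0 by apply/eqP; rewrite eq_le pi0 p0.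
  have -> : burg (0 / q i) = +oo%E by rewrite mul0r /burg le0_lneNy.
  by rewrite gt0_muley ?leey ?lte_fin.
rewrite burg_EFin ?divr_gt0// -EFinM lee_fin.
have := ln_le_subr1 _ (mulr_gt0 (y0 i) (divr_gt0 pi0 (q0 i))).
rewrite [ln (y i * _)]lnM ?posrE ?divr_gt0// -(ler_pM2l (q0 i)).
have -> : q i * (y i * (p i / q i) - 1) = p i * y i - q i.
  by field; rewrite gt_eqF.
have -> : q i * (- ln (p i / q i) + p i / q i - 1) =
    - (q i * ln (p i / q i)) + p i - q i by field; rewrite gt_eqF.
rewrite mulrDr; set u := q i * ln _; set w := q i * ln _; lra.
Qed.

End BurgDivergence.

Section Bellman.
Context {R : realType} {nS nA : nat} (M : rmdp (R := R) nS nA).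
Implicit Types (v : 'I_nS -> R) (s : 'I_nS).

Definition gain v s a s' : R := reward M s a s' + discount M * v s'.

Lemma nominal_in_ambiguity s : ambiguity M s (nominal M s).
Proof.
split=> [a|]; first exact: nominal_simplex.
rewrite big1 ?lee_fin ?(ltW (budget_gt0 M))// => a _.
rewrite burg_divergenceE; do ?[exact: nominal_simplex | exact: nominal_gt0].
rewrite big1 ?oppr0// => i _.
by rewrite divff ?ln1 ?mulr0// gt_eqF// nominal_gt0.
Qed.

Lemma simplex_le1 {n} (p : 'I_n -> R) i : simplex p -> p i <= 1.
Proof.
by move=> [p0 p1]; rewrite -p1 (bigD1 i)//= lerDl sumr_ge0.
Qed.

Lemma simplex_sum_le {n} (p f : 'I_n -> R) (x : R) : simplex p ->
  (forall i, f i <= x) -> \sum_(i < n) p i * f i <= x.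
Proof.
move=> [p0 p1] fx; rewrite -[leRHS]mul1r -[in leRHS]p1 mulr_suml.
by apply: ler_sum => i _; rewrite ler_wpM2l.
Qed.

(** Real [inf] and [sup] are meaningful on nonempty bounded sets; this supplies the boundedness for
    both. *)
Lemma payoff_bounded v s : exists B, forall pi p, simplex pi ->
  (forall a, simplex (p a)) -> `|payoff M v s pi p| <= B.
Proof.
exists (\sum_(a < nA) \sum_(s' < nS) `|gain v s a s'|) => pi p spi sp.
apply: le_trans (ler_norm_sum _ _ _) _; apply: ler_sum => a _.
rewrite normrM ger0_norm ?(spi.1)//.
apply: le_trans (ler_piMl (normr_ge0 _) (simplex_le1 _ a spi)) _.
apply: le_trans (ler_norm_sum _ _ _) _; apply: ler_sum => s' _.
rewrite normrM ger0_norm ?((sp a).1)//.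
exact: ler_piMl (normr_ge0 _) (simplex_le1 _ s' (sp a)).
Qed.

Hypothesis nA_gt0 : (0 < nA)%N.

Lemma simplex_nonempty : simplex (R := R) (n := nA) !=set0.
Proof.
exists (fun a => (a == Ordinal nA_gt0)%:R); split=> [a|]; first exact: ler0n.
rewrite (bigD1 (Ordinal nA_gt0))//= big1 ?addr0// => a.
by case: eqP.
Qed.

Lemma worst_payoff_le v s pi p : simplex pi -> ambiguity M s p ->
  inf [set payoff M v s pi p | p in ambiguity M s] <= payoff M v s pi p.
Proof.
move=> spi pP; apply: ge_inf; last by exists p.
have [B hB] := payoff_bounded v s; exists (- B) => _ [p' p'P <-].
by have := hB _ _ spi p'P.1; rewrite ler_norml => /andP[].
Qed.

(** One feasible [p] limits all policies at once, as a payoff averages the expected gains of the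
    actions. *)
Lemma bellman_le v s p x : ambiguity M s p ->
  (forall a, \sum_(s' < nS) p a s' * gain v s a s' <= x) -> bellman M v s <= x.
Proof.
move=> pP px; apply: ge_sup.
  by have [pi spi] := simplex_nonempty; eexists; exists pi.
move=> _ [pi spi <-]; apply: le_trans (worst_payoff_le _ _ _ _ spi pP) _.
exact: simplex_sum_le.
Qed.

(** A fixed policy is a candidate in the supremum. The nominal transitions make the set under the
    infimum nonempty and bound the supremum. *)
Lemma bellman_ge v s pi x : simplex pi ->
  (forall p, ambiguity M s p -> x <= payoff M v s pi p) -> x <= bellman M v s.
Proof.
move=> spi px; apply: (@le_trans _ _ (inf [set payoff M v s pi p | p in ambiguity M s])).
  apply: lb_le_inf => [|_ [p pP <-]]; last exact: px.
  by eexists; exists (nominal M s) => //; exact: nominal_in_ambiguity.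
apply: ub_le_sup; last by exists pi.
have [B hB] := payoff_bounded v s; exists B => _ [pi' spi' <-].
apply: le_trans (worst_payoff_le _ _ _ _ spi' (nominal_in_ambiguity s)) _.
exact: le_trans (ler_norm _) (hB _ _ spi' (nominal_in_ambiguity s).1).
Qed.

Lemma bellman_ge_gain v s a x : (forall s', x <= gain v s a s') ->
  x <= bellman M v s.
Proof.
move=> xg; apply: (bellman_ge _ _ (fun a' => (a' == a)%:R)).
  split=> [a'|]; first exact: ler0n.
  by rewrite (bigD1 a)//= eqxx big1 ?addr0// => a'; case: eqP.
move=> p [sp _]; rewrite /payoff (bigD1 a)//= eqxx mul1r [X in _ + X]big1 ?addr0.
  rewrite -[leLHS]mul1r -[in leLHS](sp a).2 mulr_suml.
  by apply: ler_sum => s' _; rewrite ler_wpM2l ?((sp a).1)// xg.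
by move=> a'; case: eqP => //; rewrite mul0r.
Qed.

Lemma reward_le_value_bound s a s' :
  reward M s a s' <= (1 - discount M) * value_bound M.
Proof.
rewrite /value_bound mulrA divff ?mul1r; last first.
  by rewrite gt_eqF// subr_gt0 discount_lt1.
apply: (bigmax_sup s) => //; apply: (bigmax_sup a) => //.
exact: (bigmax_sup s').
Qed.

Lemma value_bound_ge0 : 0 <= value_bound M.
Proof.
apply: mulr_ge0; last exact: bigmax_ge_id.
by rewrite invr_ge0 subr_ge0 ltW// discount_lt1.
Qed.

(** Against the feasible nominal transitions one step adds at most
    [(1 - discount M) * value_bound M] and discounts the rest, so the excess over [value_bound M]
    decays geometrically. *)
Lemma bellman_iter_le v0 : exists2 B, 0 <= B & forall t s,
  iter t (bellman M) v0 s <= value_bound M + geometric B (discount M) t.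
Proof.
exists (sup_norm v0); first exact: bigmax_ge_id.
elim=> [|t ih] s.
  rewrite /= expr0 mulr1 (le_trans (ler_norm _))// ler_wpDl ?value_bound_ge0//.
  exact: (bigmax_sup s).
rewrite iterS; apply: (bellman_le _ _ _ _ (nominal_in_ambiguity s)) => a.
apply: simplex_sum_le => [|s']; first exact: nominal_simplex.
have := ih s'; rewrite -(ler_pM2l (discount_gt0 M)) => h.
apply: le_trans (lerD (reward_le_value_bound s a s') h) _.
by rewrite /= exprS le_eqVlt; apply/orP; left; apply/eqP; ring.
Qed.

Lemma bellman_limit_le v0 vstar s :
  (fun t : nat => iter t (bellman M) v0 s) @ \oo --> vstar s ->
  vstar s <= value_bound M.
Proof.
move=> cv; have [B B0 hB] := bellman_iter_le v0.
have cg : value_bound M + geometric B (discount M) t @[t --> \oo]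
    --> value_bound M + 0.
  apply: cvgD; first exact: cvg_cst.
  apply: cvg_geometric.
  by rewrite ger0_norm ?(ltW (discount_gt0 M))// discount_lt1.
rewrite -[leRHS]addr0; apply: (ler_cvg_to cv cg).
by apply: nearW => t; exact: hB.
Qed.

Lemma gain_le_value_bound v s a s' : v s' <= value_bound M ->
  gain v s a s' <= value_bound M.
Proof.
rewrite -(ler_pM2l (discount_gt0 M)) => h.
apply: le_trans (lerD (reward_le_value_bound s a s') h) _.
by rewrite le_eqVlt; apply/orP; left; apply/eqP; ring.
Qed.

(* The policy is proportional to the multipliers [x]. *)
Lemma le_bellman_dual v s (theta : R) (x : 'I_nA -> R) :
  (forall a, 0 <= x a) ->
  (forall a i, 0 < 1 + x a * (gain v s a i - theta)) ->
  budget M < \sum_(a < nA) dual_value (nominal M s a) (gain v s a) theta (x a) ->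
  theta <= bellman M v s.
Proof.
move=> x0 xpos hsum.
(* If all multipliers vanished, so would every [dual_value], against the positive budget. *)
have X0 : 0 < \sum_(a < nA) x a.
  rewrite lt_neqAle sumr_ge0// andbT eq_sym; apply/eqP => /psumr_eq0P xa0.
  have := lt_trans (budget_gt0 M) hsum; rewrite big1 ?ltxx// => a _.
  rewrite /dual_value big1// => i _.
  by rewrite xa0// mul0r addr0 ln1 mulr0.
apply: (bellman_ge _ _ (fun a => x a / \sum_(a < nA) x a)).
  split=> [a|]; first by rewrite divr_ge0// ltW.
  by rewrite -mulr_suml divff// gt_eqF.
move=> p [sp dp].
(* Weak duality for each action, summed and combined with the feasibility of [p]. *)
have key : \sum_(a < nA) (dual_value (nominal M s a) (gain v s a) theta (x a)
    - x a * (\sum_(i < nS) p a i * gain v s a i - theta)) <= budget M.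
  rewrite -lee_fin; apply: le_trans dp; rewrite -sumEFin; apply: lee_sum => a _.
  apply: le_trans (burg_divergence_ge _ _ _ (sp a) (nominal_gt0 M s a) (xpos a)).
  rewrite lee_fin -addrA lerD2l.
  have -> : \sum_(i < nS) p a i * (1 + x a * (gain v s a i - theta)) =
      1 + x a * (\sum_(i < nS) p a i * gain v s a i - theta).
    transitivity (\sum_(i < nS) p a i + x a *
        (\sum_(i < nS) p a i * gain v s a i - theta * \sum_(i < nS) p a i));
      last by rewrite (sp a).2 mulr1.
    rewrite [theta * _]mulr_sumr -sumrB mulr_sumr -big_split.
    by apply: eq_bigr => i _ /=; ring.
  by rewrite opprD addrA subrr add0r.
have pE : payoff M v s (fun a => x a / \sum_(a < nA) x a) p =
   (\sum_(a < nA) x a * \sum_(i < nS) p a i * gain v s a i) / \sum_(a < nA) x a.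
  by rewrite mulr_suml; apply: eq_bigr => a _; rewrite mulrAC.
rewrite pE ler_pdivlMr// -subr_ge0.
suff -> : \sum_(a < nA) x a * (\sum_(i < nS) p a i * gain v s a i)
      - theta * \sum_(a < nA) x a
   = \sum_(a < nA) x a * (\sum_(i < nS) p a i * gain v s a i - theta).
  by move: key; rewrite sumrB; lra.
by rewrite [theta * _]mulr_sumr -sumrB; apply: eq_bigr => a _; ring.
Qed.

(* A multiplier [x] that certifies the divergence of the cheapest distribution
   of expected gain at most [theta] from below, and from above up to [w]. *)
Definition certificate v s a (theta w x : R) : Prop :=
  [/\ 0 <= x, forall i, 0 < 1 + x * (gain v s a i - theta) &
    exists p, [/\ simplex p, forall i, 0 < p i,
      \sum_(i < nS) p i * gain v s a i <= theta &
      - \sum_(i < nS) nominal M s a i * ln (p i / nominal M s a i)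
        <= dual_value (nominal M s a) (gain v s a) theta x + w]].

(** Concavity of [ln] between [y] and 1, where [ln 1 = 0]: the tangent bounds at [m] are averaged
    with weights [1 - t] and [t]. *)
Lemma ln_convex_comb1 (t y : R) : 0 <= t <= 1 -> 0 < y ->
  (1 - t) * ln y <= ln ((1 - t) * y + t).
Proof.
move=> /andP[t0 t1] y0; set m := (1 - t) * y + t.
have m0 : 0 < m.
  have [t1'|t1'] := eqVneq t 1; first by rewrite /m t1' subrr mul0r add0r.
  by rewrite /m ltr_wpDr// mulr_gt0// subr_gt0 lt_neqAle t1' t1.
have h1 := ln_le_subr1 _ (divr_gt0 y0 m0).
have h2 := ln_le_subr1 _ (divr_gt0 (@ltr01 R) m0).
rewrite !ln_div ?posrE// ln1 in h1 h2.
have := lerD (ler_wpM2l (_ : 0 <= 1 - t) h1) (ler_wpM2l t0 h2).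
rewrite subr_ge0 => /(_ t1).
have -> : (1 - t) * (y / m - 1) + t * (1 / m - 1) = 0.
  by rewrite /m; field; rewrite -/m gt_eqF.
by rewrite /m; lra.
Qed.

(* Moving the near-optimal transition probabilities towards the nominal ones by
   a fraction [t] restores feasibility at a cost of at most [t * beta]. *)
Lemma bellman_le_certificates v s (theta w t beta : R) (x : 'I_nA -> R) :
  0 <= theta -> 0 <= t <= 1 -> nA%:R * w <= t * budget M ->
  (forall a i, gain v s a i <= beta) -> 0 <= beta ->
  (forall a, certificate v s a theta w (x a)) ->
  \sum_(a < nA) dual_value (nominal M s a) (gain v s a) theta (x a) <= budget M ->
  bellman M v s <= theta + t * beta.
Proof.
move=> th0 /andP[t0 t1] hw hbeta beta0 hc hsum.
have [p hp] := choice (fun a => let: And3 _ _ h := hc a in h).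
pose p' a i := (1 - t) * p a i + t * nominal M s a i.
have nom := nominal_simplex M s; have nom0 := nominal_gt0 M s.
have t1' : 0 <= 1 - t by rewrite subr_ge0.
have p'0 a i : 0 < p' a i.
  have [_ p0 _ _] := hp a.
  have [e|e] := eqVneq t 1; first by rewrite /p' e subrr mul0r add0r mul1r.
  rewrite /p' ltr_wpDr ?mulr_ge0 ?(ltW (nom0 _ _))// mulr_gt0//.
  by rewrite subr_gt0 lt_neqAle e.
have p's a : simplex (p' a).
  have [[_ p1] _ _ _] := hp a.
  split=> [i|]; first exact: ltW.
  by rewrite big_split -!mulr_sumr /= p1 (nom a).2 !mulr1 subrK.
apply: (bellman_le v s p') => [|a]; last first.
  have [_ _ pt _] := hp a.
  under eq_bigr do rewrite mulrDl -!mulrA.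
  rewrite big_split -!mulr_sumr /=; apply: lerD.
    by apply: le_trans (ler_wpM2l t1' pt) _; rewrite ler_piMl// gerBl.
  by rewrite ler_wpM2l//; apply: simplex_sum_le.
split=> //.
(* The nominal distribution has divergence 0 from itself, so by convexity the mixture scales each
   divergence by at most [1 - t]. *)
have hle : (\sum_(a < nA) burg_divergence (p' a) (nominal M s a) <=
   ((1 - t) * \sum_(a < nA)
     (dual_value (nominal M s a) (gain v s a) theta (x a) + w))%:E)%E.
  rewrite mulr_sumr -sumEFin; apply: lee_sum => a _.
  have [_ p0 _ pd] := hp a.
  rewrite burg_divergenceE// lee_fin; apply: le_trans (ler_wpM2l t1' pd).
  rewrite mulrN lerN2 mulr_sumr; apply: ler_sum => i _.
  rewrite mulrCA ler_wpM2l ?(ltW (nom0 _ _))//.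
  apply: le_trans (ln_convex_comb1 t _ _ _) _; rewrite ?t0 ?divr_gt0//.
  by rewrite le_eqVlt; apply/orP; left; apply/eqP; congr ln;
     rewrite /p'; field; rewrite gt_eqF.
apply: le_trans hle _; rewrite lee_fin big_split/= sumr_const card_ord -mulr_natl.
apply: le_trans (ler_wpM2l t1' (lerD hsum hw)) _.
(* It remains that [(1 - t) * (1 + t) * budget M <= budget M]. *)
have := mulr_ge0 (sqr_ge0 t) (ltW (budget_gt0 M)).
by rewrite -subr_ge0; nra.
Qed.

(** [xopt] is the dual optimum, and its primal minimizer has divergence [dual_value xopt]. By the
    tangent bound, replacing [xopt] by the left end of a bracket loses at most the width times
    [beta]. The clause on negative slopes justifies moving the right end. *)
Lemma certificate_exists v s a (theta beta : R) (j : 'I_nS) :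
  0 <= theta -> 0 <= beta -> (forall i, gain v s a i <= beta) ->
  (forall i, gain v s a j <= gain v s a i) -> gain v s a j < theta ->
  exists xopt, [/\ xopt * (theta - gain v s a j) < 1,
  forall y, 0 <= y ->
    dual_slope (nominal M s a) (gain v s a) theta y < 0 -> xopt <= y &
  forall lo hi, 0 <= lo -> lo <= hi -> lo * (theta - gain v s a j) < 1 ->
    xopt <= hi ->
    lo = 0 \/ 0 <= dual_slope (nominal M s a) (gain v s a) theta lo ->
    certificate v s a theta ((hi - lo) * beta) lo].
Proof.
move=> th0 beta0 hbeta jmin jth.
have q0 := nominal_gt0 M s a; have [_ q1] := nominal_simplex M s a.
have [x [x0 xj sx xsx]] := dual_optimum _ _ _ q0 _ jmin jth.
have xdom := dual_domain _ _ _ _ jmin x0 xj.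
exists x; split=> // [y y0 sy|lo hi lo0 lohi loj xhi slo].
  (* Otherwise [x] would be positive with negative slope, against [xsx]. *)
  rewrite leNgt; apply/negP => yx.
  have hx : dual_slope (nominal M s a) (gain v s a) theta x < 0.
    apply: le_lt_trans sy; apply: dual_slope_antitone => //.
    by rewrite y0 ltW.
  by have := nmulr_llt0 x hx; rewrite xsx ltxx (le_lt_trans y0 yx).
have ldom := dual_domain _ _ _ _ jmin lo0 loj.
split=> //; have [p [sp p0 pt pE]] := dual_primal _ _ _ q0 q1 _ xdom sx xsx.
exists p; split=> //; rewrite pE opprK -lerBlDl.
apply: le_trans (dual_value_sub_le _ _ _ q0 _ _ ldom xdom) _.
have sb : dual_slope (nominal M s a) (gain v s a) theta lo <= beta.
  apply: le_trans (dual_slope0_le _ _ _ q0 q1 _ th0 hbeta).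
  by apply: dual_slope_antitone => //; rewrite lexx.
have [s0|s0] := leP 0 (dual_slope (nominal M s a) (gain v s a) theta lo).
  apply: le_trans (ler_wpM2r s0 (_ : _ <= hi - lo)) _; first by rewrite lerD2r.
  by rewrite ler_wpM2l// subr_ge0.
(* A negative slope at [lo] leaves only [lo = 0], and then the optimum is no better than [lo]. *)
have lo_eq0 : lo = 0 by case: slo => // /(lt_le_trans s0); rewrite ltxx.
apply: (@le_trans _ _ 0); last by rewrite mulr_ge0// subr_ge0.
by rewrite lo_eq0 in s0 *; rewrite subr0 mulr_ge0_le0// ltW.
Qed.
End Bellman.

(** * Running programs within a time bound *)

(** Syntactic bounds on what a command may change; being boolean, they let side conditions be
    decided by computation. *)
Fixpoint writes_reg (x : nat) (c : cmd) : bool :=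
  match c with
  | Skip | RSet _ _ _ => false
  | ISet y _ => x == y
  | Seq c1 c2 | If _ c1 c2 => writes_reg x c1 || writes_reg x c2
  | While _ c1 => writes_reg x c1
  end.

Fixpoint writes_array (b : nat) (c : cmd) : bool :=
  match c with
  | Skip | ISet _ _ => false
  | RSet b' _ _ => b == b'
  | Seq c1 c2 | If _ c1 c2 => writes_array b c1 || writes_array b c2
  | While _ c1 => writes_array b c1
  end.

Definition For (x y : nat) (c : cmd) : cmd :=
  Seq (ISet x (ICst 0))
    (While (ILt (IReg x) (IReg y))
       (Seq c (ISet x (IAdd (IReg x) (ICst 1))))).

(* Real variables live in cell 0 of an array of their own, so that the arrays
   written by a command tell which variables it may change. *)
Definition Var (b : nat) : rexp := RGet b (ICst 0).
Definition Assign (b : nat) (e : rexp) : cmd := RSet b (ICst 0) e.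

(** Register 4 runs over the successors, up to register 0. The sum is added to what [b] already
    holds, so a total can build up over several loops. *)
Definition SumLoop (b : nat) (e : rexp) : cmd :=
  For 4 0 (Assign b (RAdd (Var b) e)).
Definition MinLoop (b : nat) (e : rexp) : cmd :=
  For 4 0 (If (RLe e (Var b)) (Assign b e) Skip).
Definition MaxLoop (b : nat) (e : rexp) : cmd :=
  For 4 0 (If (RLe (Var b) e) (Assign b e) Skip).

Section Runs.
Context {R : realType}.
Implicit Types (st : store R) (c : cmd) (Q : store R -> Prop).

Definition frame c st st' : Prop :=
  (forall x, ~~ writes_reg x c -> ireg st' x = ireg st x) /\
  (forall b i, ~~ writes_array b c -> cell st' b i = cell st b i).

Lemma frame_refl c st : frame c st st. Proof. by []. Qed.

Lemma frame_trans c st1 st2 st3 :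
  frame c st1 st2 -> frame c st2 st3 -> frame c st1 st3.
Proof.
move=> [r1 a1] [r2 a2]; split=> [x h|b i h]; first by rewrite r2// r1.
by rewrite a2// a1.
Qed.

Lemma frame_sub c1 c st st' :
  (forall x, writes_reg x c1 -> writes_reg x c) ->
  (forall b, writes_array b c1 -> writes_array b c) ->
  frame c1 st st' -> frame c st st'.
Proof.
move=> hr ha [r a]; split=> [x h|b i h]; first by rewrite r//; apply: contra h => /hr.
by rewrite a//; apply: contra h => /ha.
Qed.

Lemma exec_frame c st T st' : exec c st T st' -> frame c st st'.
Proof.
elim=> {c st T st'}.
- by move=> st; exact: frame_refl.
- by move=> st x e; split=> //= y; case: eqP.
- move=> st b i e; split=> //= b' i'; by case: eqP.
- move=> st st1 st2 c1 c2 T1 T2 _ f1 _ f2.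
  apply: (@frame_trans _ _ st1); [apply: frame_sub f1|apply: frame_sub f2];
    by move=> //= ? ->; rewrite ?orbT.
- move=> st st1 t c1 c2 T _; case: (teval st t) => f.
    by apply: frame_sub f => //= ? ->.
  by apply: frame_sub f => //= ? ->; rewrite orbT.
- by move=> st t c _; exact: frame_refl.
- move=> st st1 st2 t c T1 T2 _ _ f1 _ f2.
  exact: frame_trans f2.
Qed.

Definition runs c st (n : nat) Q : Prop :=
  exists T st', [/\ exec c st T st', (T <= n)%N & Q st'].

Lemma runs_impl c st n n' Q Q' : runs c st n Q -> (n <= n')%N ->
  (forall st', frame c st st' -> Q st' -> Q' st') -> runs c st n' Q'.
Proof.
move=> [T [st' [e Tn q]]] nn' qq'; exists T, st'; split=> //.
  exact: leq_trans nn'.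
by apply: qq' => //; exact: exec_frame e.
Qed.

Lemma runs_skip st n Q : (0 < n)%N -> Q st -> runs Skip st n Q.
Proof. by move=> n0 q; exists 1%N, st; split=> //; exact: exec_skip. Qed.

Lemma runs_iset x e st Q : Q (set_ireg st x (ieval st e)) ->
  runs (ISet x e) st (icost e).+1 Q.
Proof. by move=> q; eexists; eexists; split; [exact: exec_iset|exact: leqnn|]. Qed.

Lemma runs_rset b i e st Q : Q (set_cell st b (ieval st i) (reval st e)) ->
  runs (RSet b i e) st (icost i + rcost e).+1 Q.
Proof. by move=> q; eexists; eexists; split; [exact: exec_rset|exact: leqnn|]. Qed.

Lemma runs_assign b e st n Q : (rcost e + 2 <= n)%N ->
  Q (set_cell st b 0 (reval st e)) -> runs (Assign b e) st n Q.
Proof.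
move=> cn q; apply: runs_impl (runs_rset b (ICst 0) e st Q q) _ _ => //.
by move: cn => /=; lia.
Qed.

Lemma runs_seq c1 c2 st n1 n2 Q1 Q : runs c1 st n1 Q1 ->
  (forall st1, frame c1 st st1 -> Q1 st1 -> runs c2 st1 n2 Q) ->
  runs (Seq c1 c2) st (n1 + n2) Q.
Proof.
move=> [T1 [st1 [e1 h1 q1]]] /(_ st1 (exec_frame _ _ _ _ e1) q1) [T2 [st2 [e2 h2 q2]]].
exists (T1 + T2)%N, st2; split=> //; last exact: leq_add.
exact: exec_seq e1 e2.
Qed.

Lemma runs_if t c1 c2 st n Q :
  (teval st t -> runs c1 st n Q) -> (~~ teval st t -> runs c2 st n Q) ->
  runs (If t c1 c2) st (tcost t + n) Q.
Proof.
move=> h1 h2; have [T [st' [e Tn q]]] : runs (if teval st t then c1 else c2) st n Q.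
  by case: ifPn.
by exists (tcost t + T)%N, st'; split=> //; [exact: exec_if|rewrite leq_add2l].
Qed.

(** The index of [I] is the number of rounds still allowed. The loop may stop early, whence the
    existential index at the exit. *)
Lemma runs_while t c (I : nat -> store R -> Prop) k st n :
  I k st -> (forall st1, frame c st st1 -> I 0%N st1 -> ~~ teval st1 t) ->
  (forall j st1, frame c st st1 -> I j.+1 st1 -> teval st1 t ->
    runs c st1 n (I j)) ->
  runs (While t c) st (k * (tcost t + n) + tcost t)
    (fun st' => ~~ teval st' t /\ exists j, I j st').
Proof.
move=> Ik I0 Ibody.
have : frame c st st by exact: frame_refl.
(* The store is generalized everywhere except as the base point of [frame], which must remain the
   initial store. *)
move: {1 3 4}st Ik => st1; elim: k st1 => [|k ih] st1 Ik fr.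
  exists (tcost t), st1; split=> //; first exact/exec_while_stop/(I0 _ fr).
    by split; [exact: I0|exists 0%N].
have [tt|tf] := boolP (teval st1 t); last first.
  exists (tcost t), st1; split=> //; first exact: exec_while_stop.
    by rewrite leq_addl.
  by split=> //; exists k.+1.
have [T1 [st2 [e1 h1 q1]]] := Ibody _ _ fr Ik tt.
have [T2 [st3 [e2 h2 q2]]] := ih st2 q1 (frame_trans _ _ _ _ fr (exec_frame _ _ _ _ e1)).
exists (tcost t + T1 + T2)%N, st3; split=> //; first exact: exec_while_step e1 e2.
by rewrite mulSn; lia.
Qed.

(** The 7 per round pays for the test (3) and the increment (4), the final 5 for the initialization
    (2) and the failing test (3). *)
Lemma runs_for x y c (I : nat -> store R -> Prop) N st n :
  x != y -> ~~ writes_reg x c -> ~~ writes_reg y c -> ireg st y = N ->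
  I 0%N (set_ireg st x 0) ->
  (forall (k : 'I_N) st1, frame (For x y c) st st1 -> ireg st1 x = k ->
    I k st1 -> runs c st1 n (fun st2 => I k.+1 (set_ireg st2 x k.+1))) ->
  runs (For x y c) st (N * (n + 7) + 5) (I N).
Proof.
move=> xy xc yc yN I0 Ibody.
pose J j st1 := [/\ frame (For x y c) st st1, ireg st1 y = N,
  ireg st1 x = (N - j)%N, (j <= N)%N & I (N - j)%N st1].
apply: (@runs_impl _ _ (2 + (N * (3 + (n + 4)) + 3)) _
  (fun st' => ~~ teval st' (ILt (IReg x) (IReg y)) /\ exists j, J j st')).
- apply: (@runs_seq _ _ _ 2 _ (J N)).
    apply: runs_iset; split; rewrite ?subnn//=; last by rewrite eqxx.
      by split=> //= z; case: eqP => [->|]//; rewrite eqxx.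
    by rewrite eq_sym (negbTE xy).
  move=> st1 _ J1; apply: (runs_while _ _ J) => //.
    by move=> st2 _ [_ yE xE _ _] /=; rewrite yE xE subn0 ltnn.
  move=> j st2 _ [fr yE xE jN Ij] _.
  have hk : (N - j.+1 < N)%N by rewrite ltn_subrL (leq_trans _ jN).
  apply: (runs_seq _ _ _ n 4).
    exact: (Ibody (Ordinal hk) _ fr xE Ij).
  have kE : (N - j)%N = (N - j.+1).+1 by rewrite -subSn// subSS.
  move=> st3 fr3 I3; apply: runs_iset.
  have x3 : ireg st3 x = (N - j.+1)%N by rewrite fr3.1.
  split=> //=.
  + apply: frame_trans fr _; split=> /= [z|b i] h.
      have [zx|zx] := eqVneq z x; first by rewrite zx eqxx in h.
      by rewrite fr3.1//; apply: contra h => ->; rewrite orbT.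
    by rewrite fr3.2//; apply: contra h => ->.
  + by rewrite eq_sym (negbTE xy) fr3.1.
  + by rewrite eqxx x3 addn1 kE.
  + exact: ltnW.
  + by rewrite x3 addn1 kE.
- by lia.
- move=> st' _ /= [nt [j [_ yE xE jN Ij]]]; move: nt Ij; rewrite yE xE -leqNgt => h.
  by have -> : (N - j)%N = N by lia.
Qed.

Lemma sum_ord_ltS N (F : 'I_N -> R) (k : 'I_N) :
  \sum_(i < N | (i < k.+1)%N) F i = \sum_(i < N | (i < k)%N) F i + F k.
Proof.
rewrite (bigD1 k)//= addrC; congr (_ + _); apply: eq_bigl => i.
by rewrite ltnS -val_eqE /= andbC -ltn_neqAle.
Qed.

Lemma runs_sum b e st N (F : 'I_N -> R) : ireg st 0 = N ->
  (forall (k : 'I_N) st1, frame (SumLoop b e) st st1 -> ireg st1 4 = k ->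
    reval st1 e = F k) ->
  runs (SumLoop b e) st (N * (rcost e + 12) + 5)
    (fun st' => cell st' b 0 = cell st b 0 + \sum_(i < N) F i).
Proof.
move=> N0 hF; pose I (k : nat) (st' : store R) :=
  cell st' b 0 = cell st b 0 + \sum_(i < N | (i < k)%N) F i.
apply: (@runs_impl _ _ (N * ((rcost e + 5) + 7) + 5) _ (I N)).
- apply: runs_for => //; first by rewrite /I /= big_pred0_eq addr0.
  move=> k st1 fr k1 Ik; apply: runs_assign; first by rewrite /=; lia.
  by rewrite /I /= !eqxx /= (hF k)// Ik sum_ord_ltS addrA.
- by lia.
- by move=> st' _; rewrite /I => ->; congr (_ + _); apply: eq_bigl => i; rewrite ltn_ord.
Qed.
(** The last clause keeps the computed maximum below any bound known in advance. *)
Lemma runs_max b e st N (F : 'I_N -> R) : ireg st 0 = N ->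
  (forall (k : 'I_N) st1, frame (MaxLoop b e) st st1 -> ireg st1 4 = k ->
    reval st1 e = F k) ->
  runs (MaxLoop b e) st (N * (2 * rcost e + 12) + 5)
    (fun st' => [/\ cell st b 0 <= cell st' b 0,
      forall i, F i <= cell st' b 0 &
      forall u, cell st b 0 <= u -> (forall i, F i <= u) -> cell st' b 0 <= u]).
Proof.
move=> N0 hF; pose I (k : nat) (st' : store R) := [/\ cell st b 0 <= cell st' b 0,
      forall i : 'I_N, (i < k)%N -> F i <= cell st' b 0 &
      forall u, cell st b 0 <= u -> (forall i, F i <= u) -> cell st' b 0 <= u].
apply: (@runs_impl _ _ (N * ((rcost e + 3 + (rcost e + 2)) + 7) + 5) _ (I N)).
- apply: runs_for => // k st1 fr k1 [Ib Ige Iu].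
  apply: runs_impl (runs_if _ _ _ _ (rcost e + 2) _ _ _) _ _;
      [| | |by move=> ? _; exact: id].
  + move=> /=; rewrite (hF k)// => le; apply: runs_assign => //=.
    rewrite /I /= !eqxx /= (hF k)//; split=> [|i|u _]; [exact: le_trans le| |exact].
    rewrite ltnS leq_eqVlt => /orP[/eqP/val_inj->//|/Ige h].
    exact: le_trans h le.
  + rewrite /= (hF k)// -ltNge => /ltW le; apply: runs_skip; first by rewrite addn2.
    split=> //= i; rewrite ltnS leq_eqVlt => /orP[/eqP/val_inj->//|].
    exact: Ige.
  + by rewrite /=; lia.
- by lia.
- by move=> st' _ [h1 h2 h3]; split=> // i; apply: h2.
Qed.

Lemma runs_min b e st N (F : 'I_N -> R) : ireg st 0 = N ->
  (forall (k : 'I_N) st1, frame (MinLoop b e) st st1 -> ireg st1 4 = k ->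
    reval st1 e = F k) ->
  runs (MinLoop b e) st (N * (2 * rcost e + 12) + 5)
    (fun st' => [/\ cell st' b 0 <= cell st b 0,
      forall i, cell st' b 0 <= F i &
      cell st' b 0 = cell st b 0 \/ exists i, cell st' b 0 = F i]).
Proof.
move=> N0 hF; pose I (k : nat) (st' : store R) := [/\ cell st' b 0 <= cell st b 0,
      forall i : 'I_N, (i < k)%N -> cell st' b 0 <= F i &
      cell st' b 0 = cell st b 0 \/ exists i, cell st' b 0 = F i].
apply: (@runs_impl _ _ (N * ((rcost e + 3 + (rcost e + 2)) + 7) + 5) _ (I N)).
- apply: runs_for => //; first by split=> //; left.
  move=> k st1 fr k1 [Ib Ile Iex].
  apply: runs_impl (runs_if _ _ _ _ (rcost e + 2) _ _ _) _ _;
      [| | |by move=> ? _; exact: id].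
  + move=> /=; rewrite (hF k)// => le; apply: runs_assign => //=.
    rewrite /I /= !eqxx /= (hF k)//; split=> [|i|]; [exact: le_trans Ib| |by right; exists k].
    rewrite ltnS leq_eqVlt => /orP[/eqP/val_inj->//|/Ile h].
    exact: le_trans le h.
  + rewrite /= (hF k)// -ltNge => /ltW le; apply: runs_skip; first by rewrite addn2.
    split=> //= i; rewrite ltnS leq_eqVlt => /orP[/eqP/val_inj->//|].
    exact: Ile.
  + by rewrite /=; lia.
- by lia.
- by move=> st' _ [h1 h2 h3]; split=> // i; apply: h2.
Qed.
End Runs.

(** * The nested bisection *)

(** Arrays 0 to 3 hold the input and array 4 the output, so working variables start at 5. *)
Local Notation vBeta := 5%N.
Local Notation vBase := 6%N.
Local Notation vMin := 7%N.
Local Notation vCount := 8%N.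
Local Notation vLo := 9%N.
Local Notation vHi := 10%N.
Local Notation vTheta := 11%N.
Local Notation vTotal := 12%N.
Local Notation vXlo := 13%N.
Local Notation vXhi := 14%N.
Local Notation vXmid := 15%N.
Local Notation vSlope := 16%N.

(* Integer registers 2, 3 and 4 hold the state, the action and the successor. *)
Definition TripleIdx : iexp :=
  IAdd (IMul (IAdd (IMul (IReg 2) (IReg 1)) (IReg 3)) (IReg 0)) (IReg 4).
Definition Discount : rexp := RGet 0 (ICst 0).
Definition Budget : rexp := RGet 0 (ICst 1).
Definition Eps : rexp := RGet 0 (ICst 2).
Definition Nominal : rexp := RGet 2 TripleIdx.
Definition Gain : rexp :=
  RAdd (RGet 1 TripleIdx) (RMul Discount (RGet 3 (IReg 4))).
Definition Excess : rexp := RSub Gain (Var vTheta).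
Definition DualSlopeTerm : rexp :=
  RMul Nominal (RDiv Excess (RAdd (RCst 1) (RMul (Var vXmid) Excess))).
Definition DualValueTerm : rexp :=
  RMul Nominal (RLn (RAdd (RCst 1) (RMul (Var vXlo) Excess))).
Definition Mid (b1 b2 : nat) : rexp := RDiv (RAdd (Var b1) (Var b2)) (RCst 2).

(** Real expressions use integer registers only as addresses, so the number of actions is counted in
    the real variable [vCount] along the way. *)
Definition MaxGain : cmd :=
  Seq (Assign vBeta (RCst 0)) (Seq (Assign vCount (RCst 0))
    (For 3 1 (Seq (MaxLoop vBeta Gain)
                  (Assign vCount (RAdd (Var vCount) (RCst 1)))))).

Definition MinGain : cmd :=
  Seq (Assign vMin (Var vBeta)) (MinLoop vMin Gain).

(** A single pure action guarantees this value. Starting the outer bisection there keeps [theta]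
    above the smallest gain of every action. *)
Definition MaxMinGain : cmd :=
  Seq (Assign vBase (RCst 0))
    (For 3 1 (Seq MinGain
      (If (RLe (Var vBase) (Var vMin)) (Assign vBase (Var vMin)) Skip))).

(** The test, cleared of denominators, asks whether [beta] times the bracket width is still at least
    the tolerated error [budget * eps / (4 * nA * beta)]. *)
Definition BisectSlope : cmd :=
  While (RLe (RMul Budget Eps)
             (RMul (RMul (RCst 4) (Var vCount))
                   (RMul (RMul (Var vBeta) (Var vBeta))
                         (RSub (Var vXhi) (Var vXlo)))))
    (Seq (Assign vXmid (Mid vXlo vXhi))
    (Seq (Assign vSlope (RCst 0))
    (Seq (SumLoop vSlope DualSlopeTerm)
         (If (RLe (RCst 0) (Var vSlope)) (Assign vXlo (Var vXmid))
                                         (Assign vXhi (Var vXmid)))))).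

Definition Multiplier : cmd :=
  Seq MinGain
  (Seq (Assign vXlo (RCst 0))
  (Seq (Assign vXhi (RDiv (RCst 1) (RSub (Var vTheta) (Var vMin))))
       BisectSlope)).

Definition TotalDivergence : cmd :=
  Seq (Assign vTotal (RCst 0))
    (For 3 1 (Seq Multiplier (SumLoop vTotal DualValueTerm))).

Definition BisectValue : cmd :=
  While (RLe Eps (RMul (RCst 2) (RSub (Var vHi) (Var vLo))))
    (Seq (Assign vTheta (Mid vLo vHi))
    (Seq TotalDivergence
         (If (RLe (Var vTotal) Budget) (Assign vHi (Var vTheta))
                                       (Assign vLo (Var vTheta))))).

Definition BellmanState : cmd :=
  Seq MaxGain (Seq MaxMinGain
  (Seq (Assign vLo (Var vBase)) (Seq (Assign vHi (Var vBeta)) BisectValue))).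

Definition Bellman : cmd := For 2 0 (Seq BellmanState (RSet 4 (IReg 2) (Var vLo))).

(** * Correctness and running time of the program *)

Section Program.
Context {R : realType} {nS nA : nat} (M : rmdp (R := R) nS nA).
Context (v : 'I_nS -> R) (eps : R).
Implicit Types (st : store R) (c : cmd) (s : 'I_nS) (a : 'I_nA).

Definition at_state st s : Prop := loaded M v eps st /\ ireg st 2 = s.
Definition at_row st s a : Prop := at_state st s /\ ireg st 3 = a.

Definition keeps_state c : bool :=
  ~~ has (writes_reg^~ c) [:: 0; 1; 2]%N && ~~ has (writes_array^~ c) [:: 0; 1; 2; 3]%N.

Lemma loaded_eq st st' : ireg st' 0 = ireg st 0 -> ireg st' 1 = ireg st 1 ->
  (forall b i, (b < 4)%N -> cell st' b i = cell st b i) ->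
  loaded M v eps st -> loaded M v eps st'.
Proof. by move=> r0 r1 h []; split; move=> *; rewrite ?r0 ?r1 ?h. Qed.

Lemma at_state_frame c st st' s :
  frame c st st' -> keeps_state c -> at_state st s -> at_state st' s.
Proof.
move=> [fr fa] /andP[]; rewrite /= !negb_or => /and4P[r0 r1 r2 _].
move=> /and5P[a0 a1 a2 a3 _] [ld st2].
split; last by rewrite fr.
apply: loaded_eq ld; rewrite ?fr// => -[|[|[|[|b]]]]// i _; exact: fa.
Qed.

Lemma at_row_frame c st st' s a :
  frame c st st' -> keeps_state c && ~~ writes_reg 3 c ->
  at_row st s a -> at_row st' s a.
Proof.
move=> fr /andP[kc r3] [sts st3]; split; last by rewrite fr.1.
exact: at_state_frame kc sts.
Qed.

Section Row.
Context (st : store R) (s : 'I_nS) (a : 'I_nA) (i : 'I_nS).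
Hypotheses (row : at_row st s a) (reg4 : ireg st 4 = i).

Lemma reval_nominal : reval st Nominal = nominal M s a i.
Proof.
have [[[l0 l1 _ _ _ _ ln _] r2] r3] := row.
by rewrite /= l0 l1 r2 r3 reg4 ln.
Qed.

Lemma reval_gain : reval st Gain = gain M v s a i.
Proof.
have [[[l0 l1 ld _ _ lr _ lv] r2] r3] := row.
by rewrite /= l0 l1 r2 r3 reg4 lr ld lv.
Qed.

End Row.

Lemma runs_le c st n n' (Q : store R -> Prop) :
  runs c st n Q -> (n <= n')%N -> runs c st n' Q.
Proof. by move=> r nn'; apply: runs_impl r nn' _. Qed.

Lemma runs_assign_eq b e st :
  runs (Assign b e) st (rcost e + 2) (fun st' => cell st' b 0 = reval st e).
Proof. by apply: runs_assign => //=; rewrite !eqxx. Qed.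

Hypothesis (nS_gt0 : (0 < nS)%N) (nA_gt0 : (0 < nA)%N) (eps_gt0 : 0 < eps).
Hypothesis gain_ge0 : forall s a i, 0 <= gain M v s a i.

Lemma runs_min_gain s a st : at_row st s a ->
  (forall i, gain M v s a i <= cell st vBeta 0) ->
  runs MinGain st (nS * 44 + 9) (fun st' => exists2 j,
    cell st' vMin 0 = gain M v s a j & forall i, gain M v s a j <= gain M v s a i).
Proof.
move=> row hbeta; eapply runs_le.
  eapply runs_seq; [exact: runs_assign_eq|] => st1 f1 E1 /=.
  have row1 := at_row_frame _ _ _ _ _ f1 isT row.
  apply: runs_impl (runs_min vMin Gain st1 nS (gain M v s a) _ _) (leqnn _) _.
  - exact: (loaded_nS row1.1.1).
  - move=> k st2 f2 k2.
    by rewrite (reval_gain _ s a k)//; exact: at_row_frame f2 isT row1.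
  - move=> st2 f2 [h1 h2 h3].
    have [j jE] : exists j, cell st2 vMin 0 = gain M v s a j.
      (* If the starting value survives, it is both an upper and a lower bound of the gains, so any
         successor attains it. *)
      case: h3 => // e; exists (Ordinal nS_gt0).
      by apply/eqP; rewrite eq_le h2 e E1 hbeta.
    by exists j => // i; rewrite -jE.
by rewrite /=; clear; lia.
Qed.

Lemma runs_max_gain s st (u : R) : at_state st s -> 0 <= u ->
  (forall a i, gain M v s a i <= u) ->
  runs MaxGain st (nA * (nS * 44 + 18) + 11) (fun st' =>
    [/\ cell st' vCount 0 = nA%:R, 0 <= cell st' vBeta 0 <= u &
        forall a i, gain M v s a i <= cell st' vBeta 0]).
Proof.
move=> hst u0 hu.
pose I (k : nat) (st' : store R) := [/\ cell st' vCount 0 = k%:R,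
   0 <= cell st' vBeta 0 <= u &
   forall a i, (a < k)%N -> gain M v s a i <= cell st' vBeta 0].
eapply runs_le.
  eapply runs_seq; [exact: runs_assign_eq|] => st1 f1 E1 /=.
  eapply runs_seq; [exact: runs_assign_eq|] => st2 f2 E2 /=.
  have hst2 := at_state_frame _ _ _ _ f2 isT (at_state_frame _ _ _ _ f1 isT hst).
  apply: (@runs_impl _ _ _ _ _ (I nA)).
  - apply: runs_for => //; first exact: loaded_nA hst2.1.
      by split=> //=; rewrite ?E2// f2.2// E1 lexx u0.
    move=> k st3 f3 k3 [I1 /andP[I2 I2'] I3].
    have row : at_row st3 s k by split=> //; exact: at_state_frame f3 isT hst2.
    eapply runs_seq.
      apply: (runs_max vBeta Gain st3 nS (gain M v s k)).
        exact: (loaded_nS row.1.1).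
      move=> i st4 f4 i4.
      by rewrite (reval_gain _ s k i)//; exact: at_row_frame f4 isT row.
    move=> st4 f4 [h1 h2 h3] /=.
    apply: runs_impl (runs_assign_eq _ _ _) (leqnn _) _ => st5 f5 E5.
    split=> /=.
    + by rewrite E5 /= f4.2// I1 natr1.
    + by rewrite f5.2// (le_trans I2)//= h3// => i; exact: hu.
    + move=> a i; rewrite f5.2// ltnS leq_eqVlt => /orP[/eqP/val_inj->//|/I3 h].
      exact: le_trans h1.
  - exact: leqnn.
  - by move=> st' _ [h1 h2 h3]; split=> // a i; exact: h3.
by rewrite /=; clear; lia.
Qed.

Lemma runs_max_min_gain s st : at_state st s -> 0 <= cell st vBeta 0 ->
  (forall a i, gain M v s a i <= cell st vBeta 0) ->
  runs MaxMinGain st (nA * (nS * 44 + 30) + 10) (fun st' =>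
    [/\ 0 <= cell st' vBase 0 <= cell st' vBeta 0,
        cell st' vBase 0 <= bellman M v s &
        forall a, exists j, gain M v s a j <= cell st' vBase 0]).
Proof.
move=> hst b0 hbeta.
pose I (k : nat) (st' : store R) :=
    [/\ 0 <= cell st' vBase 0 <= cell st' vBeta 0,
        cell st' vBase 0 <= bellman M v s &
        forall a, (a < k)%N -> exists j, gain M v s a j <= cell st' vBase 0].
eapply runs_le.
  eapply runs_seq; [exact: runs_assign_eq|] => st1 f1 E1 /=.
  have hst1 := at_state_frame _ _ _ _ f1 isT hst.
  apply: (@runs_impl _ _ _ _ _ (I nA)).
  - apply: runs_for => //; first exact: loaded_nA hst1.1.
      split=> //=; rewrite ?E1 ?lexx ?f1.2//.
      by apply: (bellman_ge_gain M v s (Ordinal nA_gt0)).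
    move=> k st2 f2 k2 [/andP[I1 I1'] I2 I3].
    have row : at_row st2 s k by split=> //; exact: at_state_frame f2 isT hst1.
    eapply runs_seq.
      apply: (runs_min_gain s k _ row) => i.
      by rewrite f2.2// f1.2.
    move=> st3 f3 [j jE jmin] /=.
    eapply (runs_if _ _ _ _ 5); rewrite /= jE f3.2// => le.
    + eapply runs_impl; [exact: runs_assign_eq|by []|] => st4 f4 E4.
      rewrite /= jE in E4; split=> /=; rewrite ?E4.
      * by rewrite (le_trans I1 le) /= f4.2// f3.2// f2.2// f1.2.
      * exact: (bellman_ge_gain M v s k).
      * move=> a; rewrite ltnS leq_eqVlt => /orP[/eqP/val_inj->|/I3[j' h]].
          by exists j.
        by exists j'; exact: le_trans le.
    + apply: runs_skip => //; rewrite -ltNge in le.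
      split=> /=; rewrite ?f3.2 ?I1//.
      move=> a; rewrite ltnS leq_eqVlt => /orP[/eqP/val_inj->|/I3//].
      by exists j; exact: ltW.
  - exact: leqnn.
  - by move=> st' _ [h1 h2 h3]; split=> // a; exact: h3.
by rewrite /=; clear; lia.
Qed.
Section Bisection.
Context (s : 'I_nS) (beta : R) (k : nat).
Hypotheses (beta_gt0 : 0 < beta)
  (gain_le : forall a i, gain M v s a i <= beta).

(* The number [k] of bisections of an initial interval of length [4 / eps]. *)
Hypothesis fuel :
  4 * nA%:R * (beta * beta) * (4 / eps) < budget M * eps * 2 ^+ k.

Let tol : R := budget M * eps / (4 * nA%:R * beta).

Definition row_data st (theta : R) : Prop :=
  [/\ cell st vBeta 0 = beta, cell st vCount 0 = nA%:R & cell st vTheta 0 = theta].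

Lemma row_data_frame c st st' theta : frame c st st' ->
  ~~ has (writes_array^~ c) [:: vBeta; vCount; vTheta] ->
  row_data st theta -> row_data st' theta.
Proof.
move=> [_ fa] /=; rewrite !negb_or => /and4P[a1 a2 a3 _] [h1 h2 h3].
by split; rewrite fa.
Qed.

Lemma certificate_weaken a theta w w' x : w <= w' ->
  certificate M v s a theta w x -> certificate M v s a theta w' x.
Proof.
move=> ww' [x0 xpos [p [sp p0 pt pd]]]; split=> //; exists p; split=> //.
by apply: le_trans pd _; rewrite lerD2l.
Qed.

Lemma runs_bisect_slope a st theta (j : 'I_nS) : at_row st s a ->
  row_data st theta -> 0 <= theta ->
  (forall i, gain M v s a j <= gain M v s a i) ->
  gain M v s a j + eps / 4 <= theta ->
  cell st vXlo 0 = 0 -> cell st vXhi 0 = 1 / (theta - gain M v s a j) ->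
  runs BisectSlope st (k * (nS * 67 + 47) + 22)
    (fun st' => certificate M v s a theta tol (cell st' vXlo 0)).
Proof.
move=> row dat th0 jmin jth lo0 hi0; set d := theta - gain M v s a j in hi0.
have d4 : eps / 4 <= d by rewrite lerBrDl.
have d0 : 0 < d by apply: lt_le_trans d4; rewrite divr_gt0.
have jlt : gain M v s a j < theta by rewrite -subr_gt0.
have [x [x1 xle xcert]] :=
  certificate_exists M v s a theta beta j th0 (ltW beta_gt0) (gain_le a) jmin jlt.
rewrite -/d in x1 xcert.
have nA0 : 0 < nA%:R :> R by rewrite ltr0n.
pose slope := dual_slope (nominal M s a) (gain M v s a) theta.
(* [n] halvings remain. [lo] stays strictly inside the domain of [dual_value], while [hi] may be its
   right end. *)
pose I (n : nat) (st' : store R) :=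
  let lo := cell st' vXlo 0 in let hi := cell st' vXhi 0 in
  [/\ 0 <= lo <= hi, lo * d < 1 /\ hi * d <= 1, x <= hi,
    lo = 0 \/ 0 <= slope lo &
    4 * nA%:R * (beta * beta) * (hi - lo) < budget M * eps * 2 ^+ n].
have gap0 : 0 < 4 * nA%:R * (beta * beta) by rewrite !mulr_gt0.
have dat_frame st1 : frame BisectSlope st st1 -> row_data st1 theta.
  by move=> f; apply: row_data_frame f _ dat.
have tst st1 : frame BisectSlope st st1 ->
  teval st1 (RLe (RMul Budget Eps) (RMul (RMul (RCst 4) (Var vCount))
     (RMul (RMul (Var vBeta) (Var vBeta)) (RSub (Var vXhi) (Var vXlo))))) =
  (budget M * eps <= 4 * nA%:R * (beta * beta) * (cell st1 vXhi 0 - cell st1 vXlo 0)).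
  move=> f; have [ld _] := at_row_frame _ _ _ _ _ f isT row.
  have [b1 b2 b3] := dat_frame _ f.
  by rewrite /= b1 b2 (loaded_budget ld.1) (loaded_eps ld.1) !mulrA.
apply: runs_impl (runs_while _ _ I k st (nS * 67 + 25) _ _ _) _ _.
- rewrite /I lo0 hi0 subr0 mul0r lexx; split; [| | |by left|].
  + by rewrite divr_ge0// ltW.
  + by rewrite ltr01 mulfVK// gt_eqF.
  + by rewrite ler_pdivlMr// ltW.
  (* The gap [eps / 4 <= d] bounds the initial width [1 / d] by [4 / eps]. *)
  + apply: le_lt_trans fuel; rewrite ler_pM2l//.
    by rewrite ler_pdivrMr// mulrAC ler_pdivlMr// mul1r; lra.
- by move=> st1 f [_ _ _ _]; rewrite tst// expr0 mulr1 -ltNge.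
- move=> n st1 f1 [/andP[l0 lh] [ld1 hd1] xh slo hfuel] _.
  have row1 : at_row st1 s a by exact: at_row_frame f1 isT row.
  have dat1 := dat_frame _ f1.
  pose mid : R := (cell st1 vXlo 0 + cell st1 vXhi 0) / 2.
  have midE : cell st1 vXhi 0 - mid = (cell st1 vXhi 0 - cell st1 vXlo 0) / 2.
    by rewrite /mid; field.
  have midE' : mid - cell st1 vXlo 0 = (cell st1 vXhi 0 - cell st1 vXlo 0) / 2.
    by rewrite /mid; field.
  have fuel' : 4 * nA%:R * (beta * beta) * ((cell st1 vXhi 0 - cell st1 vXlo 0) / 2)
      < budget M * eps * 2 ^+ n.
    by move: hfuel; rewrite exprS; lra.
  have mid_lo : cell st1 vXlo 0 <= mid by rewrite /mid; lra.
  have mid_hi : mid <= cell st1 vXhi 0 by rewrite /mid; lra.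
  have midd : mid * d < 1 by rewrite /mid; lra.
  eapply runs_le.
    eapply runs_seq; [exact: runs_assign_eq|] => st2 f2 E2.
    eapply runs_seq; [exact: runs_assign_eq|] => st3 f3 E3.
    have row3 := at_row_frame _ _ _ _ _ f3 isT (at_row_frame _ _ _ _ _ f2 isT row1).
    have [_ _ th3] := row_data_frame _ _ _ _ f3 isT (row_data_frame _ _ _ _ f2 isT dat1).
    have mid3 : cell st3 vXmid 0 = mid by rewrite f3.2// E2.
    eapply runs_seq.
      apply: (runs_sum vSlope DualSlopeTerm st3 nS (fun i =>
        nominal M s a i * ((gain M v s a i - theta) / (1 + mid * (gain M v s a i - theta))))).
        exact: loaded_nS row3.1.1.
      move=> i st4 f4 i4; have row4 := at_row_frame _ _ _ _ _ f4 isT row3.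
      have := reval_gain _ _ _ _ row4 i4; have := reval_nominal _ _ _ _ row4 i4.
      rewrite /DualSlopeTerm /Excess; cbn [reval]; move=> -> -> /=.
      by rewrite !f4.2// th3 mid3.
    move=> st4 f4; rewrite E3 /= add0r -/(dual_slope _ _ _ _) -/(slope mid) => E4.
    have lo4 : cell st4 vXlo 0 = cell st1 vXlo 0 by rewrite f4.2// f3.2// f2.2.
    have hi4 : cell st4 vXhi 0 = cell st1 vXhi 0 by rewrite f4.2// f3.2// f2.2.
    have mid4 : cell st4 vXmid 0 = mid by rewrite f4.2.
    eapply (runs_if _ _ _ _ 4); rewrite /= E4 => smid;
      (eapply runs_impl; [exact: runs_assign_eq|by []|]) => st5 f5; rewrite /= mid4 => E5.
    + rewrite /I E5 f5.2// hi4 midE; split=> //; last by right.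
      by rewrite mid_hi (le_trans l0).
    + rewrite /I E5 f5.2// lo4 midE' mid_lo l0; split=> //.
        by split=> //; exact: ltW.
      by apply: xle; [exact: le_trans mid_lo|rewrite ltNge].
  by rewrite /=; clear; lia.
- by rewrite /=; clear; lia.
- move=> st1 f1; rewrite tst// -ltNge => -[ex [n [/andP[l0 lh] [ld1 _] xh slo _]]].
  apply: certificate_weaken (xcert _ _ l0 lh ld1 xh slo).
  rewrite /tol ler_pdivlMr ?mulr_gt0//; apply: ltW.
  by apply: le_lt_trans ex; rewrite le_eqVlt; apply/orP; left; apply/eqP; ring.
Qed.

Lemma runs_multiplier a st theta : at_row st s a -> row_data st theta ->
  0 <= theta -> (exists j, gain M v s a j + eps / 4 <= theta) ->
  runs Multiplier st (k * (nS * 67 + 47) + nS * 44 + 43)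
    (fun st' => certificate M v s a theta tol (cell st' vXlo 0)).
Proof.
move=> row dat th0 [j0 hj0]; eapply runs_le.
  eapply runs_seq.
    by apply: (runs_min_gain s a) => // i; have [-> _ _] := dat.
  move=> st1 f1 [j E1 jmin].
  eapply runs_seq; [exact: runs_assign_eq|] => st2 f2 E2.
  eapply runs_seq; [exact: runs_assign_eq|] => st3 f3 E3.
  have row2 := at_row_frame _ _ _ _ _ f2 isT (at_row_frame _ _ _ _ _ f1 isT row).
  have dat2 := row_data_frame _ _ _ _ f2 isT (row_data_frame _ _ _ _ f1 isT dat).
  apply: (runs_bisect_slope a st3 theta j) => //.
  - exact: at_row_frame f3 isT row2.
  - exact: row_data_frame f3 isT dat2.
  - by apply: le_trans hj0; rewrite lerD2r.
  - by rewrite f3.2// E2.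
  - by have [_ _ th2] := dat2; rewrite E3 /= th2 f2.2// E1.
by rewrite /=; clear; lia.
Qed.

Lemma runs_total_divergence st theta : at_state st s -> row_data st theta ->
  0 <= theta -> (forall a, exists j, gain M v s a j + eps / 4 <= theta) ->
  runs TotalDivergence st (nA * (k * (nS * 67 + 47) + nS * 101 + 60) + 10)
    (fun st' => exists2 x : 'I_nA -> R,
      forall a, certificate M v s a theta tol (x a) &
      cell st' vTotal 0 =
        \sum_(a < nA) dual_value (nominal M s a) (gain M v s a) theta (x a)).
Proof.
move=> hst dat th0 hj.
pose I (n : nat) (st' : store R) := exists2 x : 'I_nA -> R,
  forall a : 'I_nA, (a < n)%N -> certificate M v s a theta tol (x a) &
  cell st' vTotal 0 =
    \sum_(a < nA | (a < n)%N) dual_value (nominal M s a) (gain M v s a) theta (x a).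
eapply runs_le.
  eapply runs_seq; [exact: runs_assign_eq|] => st1 f1 E1.
  have hst1 := at_state_frame _ _ _ _ f1 isT hst.
  have dat1 := row_data_frame _ _ _ _ f1 isT dat.
  apply: (@runs_impl _ _ _ _ _ (I nA)).
  - apply: runs_for => //; first exact: loaded_nA hst1.1.
      by exists (fun=> 0) => //; rewrite big_pred0_eq.
    move=> a st2 f2 a2 [x hx E2].
    have row : at_row st2 s a by split=> //; exact: at_state_frame f2 isT hst1.
    have dat2 := row_data_frame _ _ _ _ f2 isT dat1.
    eapply runs_seq; [exact: (runs_multiplier a _ theta)|] => st3 f3 cert.
    have row3 := at_row_frame _ _ _ _ _ f3 isT row.
    have [_ _ th3] := row_data_frame _ _ _ _ f3 isT dat2.
    apply: runs_impl (runs_sum vTotal DualValueTerm st3 nS (fun i =>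
        nominal M s a i * ln (1 + cell st3 vXlo 0 * (gain M v s a i - theta))) _ _)
      (leqnn _) _.
    + exact: loaded_nS row3.1.1.
    + move=> i st4 f4 i4; have row4 := at_row_frame _ _ _ _ _ f4 isT row3.
      have := reval_gain _ _ _ _ row4 i4; have := reval_nominal _ _ _ _ row4 i4.
      rewrite /DualValueTerm /Excess; cbn [reval]; move=> -> -> /=.
      by rewrite !f4.2// th3.
    + move=> st4 f4 E4.
      (* The new multiplier is recorded at [a]; those of earlier actions persist. *)
      pose x' b := if b == a then cell st3 vXlo 0 else x b.
      have x'E (b : 'I_nA) : (b < a)%N -> x' b = x b.
        by rewrite /x'; case: eqP => // ->; rewrite ltnn.
      exists x' => [b|].
        rewrite ltnS leq_eqVlt => /orP[/eqP/val_inj->|ba]; first by rewrite /x' eqxx.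
        by rewrite x'E//; exact: hx.
      rewrite sum_ord_ltS [x' a]/x' eqxx /= E4 f3.2// E2; congr (_ + _).
      by apply: eq_bigr => b ba; rewrite x'E.
  - exact: leqnn.
  - move=> st' _ [x hx E]; exists x => [a|]; first exact: hx.
    by rewrite E; apply: eq_bigl => a; rewrite ltn_ord.
by rewrite /=; clear; lia.
Qed.

End Bisection.

(** [lo] is always a true lower bound, [hi] an upper bound up to [eps / 4]. This slack does not
    accumulate, because each new [hi] is certified afresh; at the exit it adds to a bracket shorter
    than [eps / 2]. *)
Lemma runs_bisect_value s st (beta base : R) k m :
  0 <= base -> base <= bellman M v s ->
  (forall a, exists j, gain M v s a j <= base) ->
  (forall a i, gain M v s a i <= beta) ->
  4 * nA%:R * (beta * beta) * (4 / eps) < budget M * eps * 2 ^+ k ->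
  2 * beta < eps * 2 ^+ m ->
  at_state st s -> cell st vBeta 0 = beta -> cell st vCount 0 = nA%:R ->
  cell st vLo 0 = base -> cell st vHi 0 = beta -> base <= beta ->
  runs BisectValue st
    (m * (nA * (k * (nS * 67 + 47) + nS * 101 + 60) + 38) + 10)
    (fun st' => `|cell st' vLo 0 - bellman M v s| <= eps).
Proof.
move=> base0 baseJ hbase hbeta fuelk fuelm hst b1 b2 lo0 hi0 base_beta.
pose I (n : nat) (st' : store R) :=
  let lo := cell st' vLo 0 in let hi := cell st' vHi 0 in
  [/\ base <= lo <= hi, hi <= beta, lo <= bellman M v s,
    bellman M v s <= hi + eps / 4 & 2 * (hi - lo) < eps * 2 ^+ n].
have tst st1 : frame BisectValue st st1 ->
  teval st1 (RLe Eps (RMul (RCst 2) (RSub (Var vHi) (Var vLo)))) =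
  (eps <= 2 * (cell st1 vHi 0 - cell st1 vLo 0)).
  move=> f; have [ld _] := at_state_frame _ _ _ _ f isT hst.
  by rewrite /= (loaded_eps ld).
have J_beta : bellman M v s <= beta.
  apply: (bellman_le M nA_gt0 v s _ _ (nominal_in_ambiguity M s)) => a.
  by apply: simplex_sum_le => //; exact: nominal_simplex.
apply: runs_impl (runs_while _ _ I m st
  (nA * (k * (nS * 67 + 47) + nS * 101 + 60) + 28) _ _ _) _ _.
- rewrite /I lo0 hi0 lexx base_beta; split=> //.
    by apply: le_trans J_beta _; rewrite lerDl divr_ge0// ltW.
  by apply: le_lt_trans fuelm; rewrite ler_pM2l// gerBl.
- by move=> st1 f [_ _ _ _]; rewrite tst// expr0 mulr1 -ltNge.
- move=> n st1 f1 [/andP[base_lo lh] hb loJ Jhi hfuel]; rewrite tst// => gap.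
  have hst1 := at_state_frame _ _ _ _ f1 isT hst.
  pose theta : R := (cell st1 vLo 0 + cell st1 vHi 0) / 2.
  have [th_lo th_hi] : cell st1 vLo 0 <= theta /\ theta <= cell st1 vHi 0.
    by rewrite /theta; split; lra.
  (* While the loop runs, [hi - lo] is at least [eps / 2]; this keeps [theta] away from the minimal
     gains and the inner brackets short. *)
  have th_gap : cell st1 vLo 0 + eps / 4 <= theta by rewrite /theta; lra.
  have th0 : 0 <= theta by apply: le_trans base0 (le_trans base_lo th_lo).
  (* It makes [beta] positive and the mixing fraction [eps / (4 * beta)] at most 1. *)
  have beta4 : eps <= 4 * beta by lra.
  have beta_gt0 : 0 < beta by move: (lt_le_trans eps_gt0 beta4); lra.
  have halfE : eps * 2 ^+ n = eps * 2 ^+ n.+1 / 2 by rewrite exprS; field.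
  have fuel_lo : 2 * (theta - cell st1 vLo 0) < eps * 2 ^+ n.
    by rewrite halfE; move: hfuel; set z := eps * _; rewrite /theta; lra.
  have fuel_hi : 2 * (cell st1 vHi 0 - theta) < eps * 2 ^+ n.
    by rewrite halfE; move: hfuel; set z := eps * _; rewrite /theta; lra.
  eapply runs_le.
    eapply runs_seq; [exact: runs_assign_eq|] => st2 f2 E2.
    have hst2 := at_state_frame _ _ _ _ f2 isT hst1.
    eapply runs_seq.
      apply: (runs_total_divergence s beta k _ _ _ st2 theta) => //.
        by split; [rewrite f2.2// f1.2|rewrite f2.2// f1.2|].
      move=> a; have [j hj] := hbase a; exists j.
      by apply: le_trans th_gap; rewrite lerD2r (le_trans hj).
    move=> st3 f3 [x cert E3].
    have hst3 := at_state_frame _ _ _ _ f3 isT hst2.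
    have th3 : cell st3 vTheta 0 = theta by rewrite f3.2// E2.
    have lo3 : cell st3 vLo 0 = cell st1 vLo 0 by rewrite f3.2// f2.2.
    have hi3 : cell st3 vHi 0 = cell st1 vHi 0 by rewrite f3.2// f2.2.
    eapply (runs_if _ _ _ _ 4); rewrite /= (loaded_budget hst3.1) E3 => tot;
      (eapply runs_impl; [exact: runs_assign_eq|by []|]) => st4 f4; rewrite /= th3 => E4.
    + rewrite /I E4 f4.2// lo3; split=> //; first by rewrite base_lo.
        exact: le_trans hb.
      (* With the fraction [t = eps / (4 * beta)], the errors of all actions add up to
         [t * budget M], and the cost [t * beta] is [eps / 4]. *)
      have -> : eps / 4 = eps / (4 * beta) * beta by field; rewrite gt_eqF.
      apply: (bellman_le_certificates M nA_gt0 v s theta _ _ beta x) cert tot => //.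
      * rewrite divr_ge0 ?(ltW eps_gt0) ?mulr_ge0 ?(ltW beta_gt0)//=.
        by rewrite ler_pdivrMr ?mul1r// mulr_gt0.
      * rewrite le_eqVlt; apply/orP; left; apply/eqP; field.
        by rewrite pnatr_eq0 -lt0n nA_gt0 gt_eqF.
      * exact: ltW.
    + rewrite /I E4 f4.2// hi3; split=> //; first by rewrite (le_trans base_lo).
      apply: (le_bellman_dual M v s theta x); last by rewrite ltNge.
        by move=> a; have [] := cert a.
      by move=> a; have [] := cert a.
  by rewrite /=; clear; lia.
- by rewrite /=; clear; lia.
- move=> st1 f1; rewrite tst// -ltNge => -[ex [n [/andP[_ lh] hb loJ Jhi _]]].
  by rewrite distrC ger0_norm ?subr_ge0//; lra.
Qed.

Lemma runs_bellman_state s st k m :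
  (forall a i, gain M v s a i <= value_bound M) ->
  16 * nA%:R * (value_bound M) ^+ 2 < budget M * eps ^+ 2 * 2 ^+ k ->
  2 * value_bound M < eps * 2 ^+ m -> at_state st s ->
  runs BellmanState st (nA * (nS * 88 + 48) + 29 +
      (m * (nA * (k * (nS * 67 + 47) + nS * 101 + 60) + 38) + 10))
    (fun st' => `|cell st' vLo 0 - bellman M v s| <= eps).
Proof.
move=> gain_le fuelk fuelm hst; eapply runs_le.
  eapply runs_seq.
    exact: (runs_max_gain s _ _ hst (value_bound_ge0 M) gain_le).
  move=> st1 f1 [count1 /andP[beta0 beta_le] hbeta].
  have hst1 := at_state_frame _ _ _ _ f1 isT hst.
  eapply runs_seq; [exact: (runs_max_min_gain s)|] => st2 f2 [/andP[base0 bb] baseJ hbase].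
  have hst2 := at_state_frame _ _ _ _ f2 isT hst1.
  eapply runs_seq; [exact: runs_assign_eq|] => st3 f3 E3.
  have hst3 := at_state_frame _ _ _ _ f3 isT hst2.
  eapply runs_seq; [exact: runs_assign_eq|] => st4 f4 E4.
  have hst4 := at_state_frame _ _ _ _ f4 isT hst3.
  rewrite (f2.2 vBeta)// in bb.
  apply: (runs_bisect_value s st4 (cell st1 vBeta 0) _ k m base0) => //.
  (* The iteration counts are fixed in terms of [value_bound M], which dominates the computed
     maximal gain. *)
  - rewrite (mulrA _ 4 eps^-1) ltr_pdivrMr//.
    apply: le_lt_trans (_ : 16 * nA%:R * value_bound M ^+ 2 < _).
      have -> : 4 * nA%:R * (cell st1 vBeta 0 * cell st1 vBeta 0) * 4 =
        16 * nA%:R * (cell st1 vBeta 0 * cell st1 vBeta 0) by ring.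
      by rewrite ler_wpM2l ?mulr_ge0// expr2 ler_pM.
    by apply: lt_le_trans fuelk _; rewrite le_eqVlt; apply/orP; left; apply/eqP; ring.
  - by apply: le_lt_trans fuelm; rewrite ler_pM2l.
  - by rewrite f4.2// f3.2// f2.2.
  - by rewrite f4.2// f3.2// f2.2.
  - by rewrite f4.2// E3.
  - by rewrite E4 /= f3.2// f2.2.
by rewrite /=; clear; lia.
Qed.
End Program.

(** 504 is the sum of all coefficients on the left, and each monomial there divides
    [nS ^ 2 * nA * k * m]. *)
Lemma operation_count_le nS nA k m :
  (0 < nS)%N -> (0 < nA)%N -> (0 < k)%N -> (0 < m)%N ->
  (nS * (nA * (nS * 88 + 48) + 29 +
      (m * (nA * (k * (nS * 67 + 47) + nS * 101 + 60) + 38) + 10) + 4 + 7) + 5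
   <= 504 * (nS * (nS * nA * k * m)))%N.
Proof.
case: nS nA k m => [//|s] [//|a] [//|k] [//|m] _ _ _ _; nia.
Qed.

Lemma runs_bellman {R : realType} {nS nA : nat} (M : rmdp (R := R) nS nA)
    (v : 'I_nS -> R) (eps : R) (st : store R) k m :
  (0 < nS)%N -> (0 < nA)%N -> 0 < eps ->
  (forall s a i, 0 <= gain M v s a i <= value_bound M) ->
  16 * nA%:R * (value_bound M) ^+ 2 < budget M * eps ^+ 2 * 2 ^+ k ->
  2 * value_bound M < eps * 2 ^+ m -> loaded M v eps st ->
  (0 < k)%N -> (0 < m)%N ->
  runs Bellman st (504 * (nS * (nS * nA * k * m)))
    (fun st' => forall s, `|output st' s - bellman M v s| <= eps).
Proof.
move=> nS0 nA0 eps0 hgain fuelk fuelm ld k0 m0.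
pose I (n : nat) (st' : store R) :=
  forall s : 'I_nS, (s < n)%N -> `|cell st' 4 s - bellman M v s| <= eps.
apply: (@runs_impl _ _ _ _ _ (I nS)); [|exact: operation_count_le|];
  last by move=> st' _ h s; exact: h.
apply: runs_for => //; first exact: loaded_nS ld.
move=> s st1 f1 s1 I1.
have hst : at_state M v eps st1 s.
  split=> //; apply: loaded_eq ld; rewrite ?f1.1// => -[|[|[|[|b]]]]// i _; exact: f1.2.
apply: (runs_seq _ _ _ _ 4).
  apply: (runs_bellman_state M v eps _ _ _ _ s st1 k m) => //.
  - by move=> s' a i; have /andP[] := hgain s' a i.
  - by move=> a i; have /andP[] := hgain s a i.
move=> st2 f2 J2; apply: runs_rset => s' /=.
rewrite (f2.1 2)// s1 ltnS leq_eqVlt => /orP[/eqP/val_inj->|ss'].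
  by rewrite eqxx.
by rewrite ltn_eqF//= f2.2//; exact: I1.
Qed.

(** * From bisection counts to logarithmic factors *)

Lemma logf_ge1 {R : realType} (x : R) : 1 <= logf x.
Proof. by rewrite /logf le_max lexx. Qed.

Lemma logf_le_id {R : realType} (x : R) : 1 <= x -> logf x <= x.
Proof.
move=> x1; rewrite /logf ge_max x1/= (le_trans (ln_le_subr1 _ _))//.
  exact: lt_le_trans x1.
by rewrite gerBl.
Qed.

(** The logarithm of a product is a sum, and two numbers that are at least 1 sum to at most twice
    their product. *)
Lemma logf_mul_le {R : realType} (x y : R) : 0 <= x -> 0 <= y ->
  logf (x * y) <= 2 * (logf x * logf y).
Proof.
move=> x0 y0; have lx := logf_ge1 x; have ly := logf_ge1 y.
have h : logf x + logf y <= 2 * (logf x * logf y) by nra.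
apply: le_trans h; rewrite {1}/logf ge_max; apply/andP; split; first by lra.
have lxy : 0 <= logf x + logf y by lra.
(* A zero factor makes the product 0, where [ln] takes the default value 0. *)
have [xE|xn] := eqVneq x 0; first by rewrite {1}xE mul0r ln0.
have [yE|yn] := eqVneq y 0; first by rewrite {1}yE mulr0 ln0.
have xpos : 0 < x by rewrite lt_neqAle eq_sym xn.
have ypos : 0 < y by rewrite lt_neqAle eq_sym yn.
by rewrite lnM ?posrE// lerD// /logf le_max lexx orbT.
Qed.

(** As [ln 2 >= 1 / 2], any exponent above [2 * logf x] works; rounding up costs at most 1, hence at
    most one more [logf x]. *)
Lemma exists_pow2_gt {R : realType} (x : R) : exists k,
  [/\ (0 < k)%N, x < 2 ^+ k & k%:R <= 3 * logf x].
Proof.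
have l1 := logf_ge1 x; set k := Num.trunc (2 * logf x).
have l20 : 0 <= 2 * logf x by lra.
have /andP[k1 k2] := truncn_itv l20.
exists k.+1; split=> //; last first.
  by rewrite -natr1; move: k1; rewrite -/k; lra.
have [x0|x0] := leP x 0; first by apply: le_lt_trans x0 _; rewrite exprn_gt0.
rewrite -ltr_ln ?posrE ?exprn_gt0// lnXn//.
(* From [ln t <= t - 1] at [t = 1 / 2]. *)
have ln2 : 2^-1 <= ln (2 : R).
  have h0 : 0 < 2^-1 :> R by rewrite invr_gt0.
  by have := ln_le_subr1 _ h0; rewrite lnV ?posrE//; lra.
apply: (@le_lt_trans _ _ (logf x)); first by rewrite /logf le_max lexx orbT.
rewrite -[ltRHS]mulr_natl; apply: lt_le_trans (ler_wpM2l (ler0n _ _) ln2).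
by rewrite ltr_pdivlMr// mulrC.
Qed.

Theorem corollary2 (R : realType) :
  exists (c : cmd) (C : R), 0 < C /\
    forall (nS nA : nat) (M : rmdp (R := R) nS nA)
      (v0 vstar v : 'I_nS -> R) (eps : R) (st : store R),
      (0 < nS)%N -> (0 < nA)%N ->
      (forall s, (fun t : nat => iter t (bellman M) v0 s) @ \oo --> vstar s) ->
      (forall s, v s <= vstar s) ->
      (forall s a s', 0 <= reward M s a s' + discount M * v s') ->
      0 < eps ->
      loaded M v eps st ->
      exists (T : nat) (st' : store R),
        exec c st T st' /\
        sup_norm (fun s => output st' s - bellman M v s) <= eps /\
        T%:R <= C * (nS%:R ^+ 2 * (nA%:R * logf nA%:R)
                     * logf (value_bound M ^+ 2 / (eps ^+ 2 * budget M))
                     * logf (value_bound M / eps)).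
Proof.
(* 504 comes from the operation count, 192 and 12 from the bounds on the inner and outer numbers of
   bisections. *)
exists Bellman, (504 * (192 * 12)); split.
  by do 2?[apply: mulr_gt0]; rewrite ltr0n.
move=> nS nA M v0 vstar v eps st nS0 nA0 cv vle gain0 eps0 ld.
set y := value_bound M ^+ 2 / _; set z := value_bound M / eps.
have u0 := value_bound_ge0 M; have kap0 := budget_gt0 M.
have y0 : 0 <= y.
  by apply: divr_ge0; [|apply: mulr_ge0; [|exact: ltW]]; exact: sqr_ge0.
have z0 : 0 <= z by exact: divr_ge0 u0 (ltW eps0).
have [k [k0 kfuel kle]] := exists_pow2_gt (16 * nA%:R * y).
have [m [m0 mfuel mle]] := exists_pow2_gt (2 * z).
have hgain s a i : 0 <= gain M v s a i <= value_bound M.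
  rewrite gain0 /=; apply: gain_le_value_bound.
  exact: le_trans (vle i) (bellman_limit_le M nA0 _ _ _ (cv i)).
have [] := runs_bellman M v eps st k m nS0 nA0 eps0 hgain _ _ ld k0 m0.
- have e2k : 0 < eps ^+ 2 * budget M by rewrite mulr_gt0 ?exprn_gt0.
  move: kfuel; rewrite /y mulrA ltr_pdivrMr// => h.
  by apply: lt_le_trans h _; rewrite le_eqVlt; apply/orP; left; apply/eqP; ring.
- by move: mfuel; rewrite /z mulrA ltr_pdivrMr// [ltRHS]mulrC.
move=> T [st' [e Tle J]]; exists T, st'; split=> //; split.
  by apply: bigmax_le => [|s _]; [exact: ltW|exact: J].
have [lA ly lz] : [/\ 1 <= logf nA%:R :> R, 1 <= logf y & 1 <= logf z].
  by split; exact: logf_ge1.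
(* [192 = 3 * 2 * (2 * 16)]: the rounding factor 3, two splittings of a product, and
   [logf 16 <= 16]. The factor [logf nA%:R] enters here. *)
have kle' : k%:R <= 192 * (logf nA%:R * logf y).
  have h1 : logf (16 * nA%:R * y) <= 2 * (logf (16 * nA%:R) * logf y).
    by apply: logf_mul_le => //; rewrite mulr_ge0.
  have h2 : logf (16 * nA%:R) <= 2 * (logf (16 : R) * logf nA%:R).
    exact: logf_mul_le.
  have h3 : logf (16 : R) <= 16 by apply: logf_le_id; rewrite ler1n.
  have h4 : logf (16 * nA%:R) <= 32 * logf nA%:R :> R by nra.
  have h5 : logf (16 * nA%:R) * logf y <= 32 * logf nA%:R * logf y.
    by rewrite ler_wpM2r//; lra.
  lra.
(* Likewise [12 = 3 * 2 * 2], with [logf 2 <= 2]. *)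
have mle' : m%:R <= 12 * logf z.
  have h1 : logf (2 * z) <= 2 * (logf (2 : R) * logf z) by exact: logf_mul_le.
  have h2 : logf (2 : R) <= 2 by apply: logf_le_id; rewrite ler1n.
  have h3 : logf (2 : R) * logf z <= 2 * logf z by rewrite ler_wpM2r//; lra.
  lra.
have km : k%:R * m%:R <= 192 * (logf nA%:R * logf y) * (12 * logf z).
  exact: ler_pM.
apply: (@le_trans _ _ (504 * (nS%:R ^+ 2 * nA%:R * (k%:R * m%:R)))).
  apply: le_trans (_ : (504 * (nS * (nS * nA * k * m)))%:R <= _).
    by rewrite ler_nat.
  by rewrite !natrM le_eqVlt; apply/orP; left; apply/eqP; ring.
have -> : 504 * (192 * 12) * (nS%:R ^+ 2 * (nA%:R * logf nA%:R) * logf y * logf z) =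
    504 * (nS%:R ^+ 2 * nA%:R * (192 * (logf nA%:R * logf y) * (12 * logf z))) by ring.
apply: ler_wpM2l; first exact: ler0n.
apply: ler_wpM2l km; apply: mulr_ge0; [exact: exprn_ge0|exact: ler0n].
Qed.
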